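(* Let $\varphi$ be an analytic function on $\mathbb{D}$ of the form $\varphi(z)=1+B_1z+B_2z^2+B_3z^3+\cdots$ with $B_1>0$ and $B_2\in\mathbb{R}$. Let $\lambda\geq 0$, let $f(z)=z+\sum_{n=2}^\infty a_nz^n$ belong to $\mathcal{R}_\sigma(\lambda,\varphi)$, and put $\tau:=(1+\lambda)^2/(1+2\lambda)$. (a) If $\tau B_2\leq B_1^2$, then \[ |a_2|\leq \frac{B_1 \sqrt{B_1}}{ \sqrt{(1+2\lambda) (B_1^2-\tau B_2+\tau B_1)}} \quad \text{and}\quad |a_3|\leq \frac{B_1}{1+2\lambda}\max\left\{\frac{B_1^2}{B_1^2-\tau B_2+\tau B_1},\, 1 \right\}. \] (b) If $\tau B_2\geq B_1^2$, then \[ |a_2|\leq \frac{B_1\sqrt{B_1}}{\sqrt{(1+2\lambda)(\tau B_2+\tau B_1-B_1^2)}} \quad \text{and} \quad |a_3|\leq \frac{B_1}{1+2\lambda}\max\left\{\frac{B_1^2}{\tau B_2+\tau B_1-B_1^2},\, 1 \right\}. \]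
   Context: $\mathbb{D}:=\{z\in\mathbb{C}:|z|<1\}$. $\mathcal{A}$ is the class of analytic functions on $\mathbb{D}$ of the form $f(z)=z+\sum_{n=2}^\infty a_nz^n$. A function $f\in\mathcal{A}$ is bi-univalent if $f$ is univalent (injective) in $\mathbb{D}$ and its inverse $f^{-1}$ (which, by the Koebe one-quarter theorem, is defined in a disk around $0$ of radius at least $1/4$) has an analytic extension $g$ to $\mathbb{D}$ that is univalent in $\mathbb{D}$. The class of bi-univalent functions is denoted $\sigma$. For analytic functions $F,G$ on $\mathbb{D}$, $F$ is subordinate to $G$, written $F(z)\prec G(z)$, if there is a Schwarz function $w$ (analytic $w:\mathbb{D}\to\mathbb{D}$ with $w(0)=0$) such that $F=G\circ w$. For $\lambda\ge 0$ and $\varphi$ analytic in $\mathbb{D}$ of the form $\varphi(z)=1+B_1z+B_2z^2+\cdots$ with $B_1>0$, a bi-univalent function $f$ is in the class $\mathcal{R}_\sigma(\lambda,\varphi)$ if \[ (1-\lambda)\frac{f(z)}{z}+\lambda f'(z)\prec \varphi(z) \quad\text{and}\quad (1-\lambda)\frac{g(w)}{w}+\lambda g'(w)\prec \varphi(w), \] where $g$ denotes the univalent extension of $f^{-1}$ to $\mathbb{D}$ (the quotients being given their value $1$ at the origin). *)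

(* Defs.v *)
(* Stdlib reals with Coquelicot's complex numbers. *)
From Stdlib Require Import Reals.
From Coquelicot Require Import Coquelicot.

Open Scope R_scope.

Definition unit_disk (z : C) : Prop := Cmod z < 1.

(* Local representability by a power series around every point of the disk. *)
Definition analytic_on_disk (f : C -> C) : Prop :=
  forall z0 : C, unit_disk z0 ->
    exists (a : nat -> C) (r : R), 0 < r /\
      forall h : C, Cmod h < r -> is_pseries a h (f (z0 + h)%C).

Definition univalent (f : C -> C) : Prop :=
  analytic_on_disk f /\
  forall z1 z2 : C, unit_disk z1 -> unit_disk z2 -> f z1 = f z2 -> z1 = z2.

Definition has_expansion (f : C -> C) (a : nat -> C) : Prop :=
  forall z : C, unit_disk z -> is_pseries a z (f z).

Definition normalized_expansion (f : C -> C) (a : nat -> C) : Prop :=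
  a 0%nat = RtoC 0 /\ a 1%nat = RtoC 1 /\ has_expansion f a.

Definition class_A (f : C -> C) : Prop :=
  analytic_on_disk f /\ exists a : nat -> C, normalized_expansion f a.

(* For univalent f in class_A, Koebe's one-quarter theorem says that f maps the
   unit disk onto a set containing the disk of radius 1/4, so the last clause
   says exactly that g coincides with the inverse of f on that smaller disk. *)
Definition univalent_inverse_extension (f g : C -> C) : Prop :=
  univalent g /\
  forall z : C, unit_disk z -> Cmod (f z) < 1 / 4 -> g (f z) = z.

Definition bi_univalent (f : C -> C) : Prop :=
  class_A f /\ univalent f /\
  exists g : C -> C, univalent_inverse_extension f g.

Definition schwarz_function (w : C -> C) : Prop :=
  analytic_on_disk w /\
  (forall z : C, unit_disk z -> unit_disk (w z)) /\
  w (RtoC 0) = RtoC 0.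

Definition subordinate (F G : C -> C) : Prop :=
  exists w : C -> C, schwarz_function w /\
    forall z : C, unit_disk z -> F z = G (w z).

(* f(z)/z, with its removable singularity at 0 filled in for f in class_A. *)
Definition quotient_by_id (f : C -> C) (z : C) : C :=
  if Ceq_dec z (RtoC 0) then RtoC 1 else (f z / z)%C.

Definition lambda_mean (lam : R) (f : C -> C) (z : C) : C :=
  (RtoC (1 - lam) * quotient_by_id f z + RtoC lam * C_derive f z)%C.

(* The extension g is unique on the disk by the identity theorem, so "exists g"
   in the last clause refers to the g provided by bi_univalent. *)
Definition class_R_sigma (lam : R) (phi f : C -> C) : Prop :=
  bi_univalent f /\
  subordinate (lambda_mean lam f) phi /\
  exists g : C -> C,
    univalent_inverse_extension f g /\
    subordinate (lambda_mean lam g) phi.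

(* Main.v *)
Require Import Defs.
From Stdlib Require Import Reals Lra Lia Psatz Classical ClassicalEpsilon.
From Coquelicot Require Import Coquelicot.

(** Let u and v be the Schwarz functions of the two subordinations, with coefficients
    u1, u2 and v1, v2.  Since g inverts f near 0, g(w) = w - a2 w^2 + (2 a2^2 - a3) w^3 + ...
    ([inverse_coef]), and comparing coefficients ([lambda_mean_jet], [subordinate_coef]) gives

      (1 + lam) a2 = B1 u1,      (1 + 2 lam) a3 = B1 u2 + B2 u1^2,
      - (1 + lam) a2 = B1 v1,    (1 + 2 lam) (2 a2^2 - a3) = B1 v2 + B2 v1^2.

    So v1 = - u1.  The only analytic input is the sharp inequality |u2| <= 1 - |u1|^2 for a
    Schwarz function ([schwarz_function_coef]), used for u and for v.  The two equations in the
    right column, added, tie u2 + v2 to u1^2 and limit |u1|; combined so as to isolate a3,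
    they bound |a3| by an affine function of |u1|^2.  This elementary part is
    [coefficient_bounds]; parts (a) and (b) of the theorem are the two signs of
    B1^2 - tau B2.

    Analyticity means local representability by power series, and the coefficient inequality
    for Schwarz functions is global on the disk.  It is reached without contour integrals.
    A function is described at each point by its finite Taylor expansions
    ([jet]), which are stable under sums, products, inverses, composition and division
    by z, and which the derivative of a power series inherits ([derivative_jet]).  The maximum
    principle then follows from an average over four points ([four_point_mean],
    [maximum_principle]): with a term e |z|^2 added, |F|^2 is strictly subharmonic and has no
    interior maximum.  The Schwarz lemma and its Schwarz--Pick form follow as usual. *)

Open Scope R_scope.

(** * Germs at the origin and their jets *)

(** A germ-level property.  An explicit radius replaces the neighbourhood filter, so
    that disks of different radii can be compared by linear arithmetic. *)
Definition near0 (P : C -> Prop) : Prop :=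
  exists r : R, 0 < r /\ forall h : C, Cmod h < r -> P h.

Lemma near0_and (P Q : C -> Prop) :
  near0 P -> near0 Q -> near0 (fun h => P h /\ Q h).
Proof.
intros [r [Hr HP]] [s [Hs HQ]]; exists (Rmin r s); split.
- now apply Rmin_pos.
- intros h Hh; split; [apply HP | apply HQ];
    (apply Rlt_le_trans with (1 := Hh)); [apply Rmin_l | apply Rmin_r].
Qed.

Lemma near0_imp (P Q : C -> Prop) :
  (forall h, P h -> Q h) -> near0 P -> near0 Q.
Proof. intros H [r [Hr HP]]; exists r; split; auto. Qed.

Lemma near0_all (P : C -> Prop) : (forall h, P h) -> near0 P.
Proof. intros H; exists 1; split; [lra | auto]. Qed.

Lemma near0_ball (r : R) : 0 < r -> near0 (fun h => Cmod h < r).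
Proof. intros Hr; exists r; auto. Qed.

Lemma near0_at0 (P : C -> Prop) : near0 P -> P (RtoC 0).
Proof. intros [r [Hr HP]]; apply HP; now rewrite Cmod_0. Qed.

Lemma near0_nonzero (P : C -> Prop) : near0 P -> exists h, h <> RtoC 0 /\ P h.
Proof.
intros [r [Hr HP]]; exists (RtoC (r / 2)); split.
- intros E; apply RtoC_inj in E; lra.
- apply HP; rewrite Cmod_R, Rabs_pos_eq; lra.
Qed.

Lemma near0_translate (P : C -> Prop) : near0 P ->
  near0 (fun z => near0 (fun h => P (z + h)%C)).
Proof.
intros [r [Hr H]]; exists (r / 2); split; [lra|]; intros z Hz.
exists (r / 2); split; [lra|]; intros h Hh; apply H.
eapply Rle_lt_trans; [apply Cmod_triangle|lra].
Qed.

Lemma near0_translate_neq0 (z : C) : z <> RtoC 0 -> near0 (fun h => z + h <> RtoC 0)%C.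
Proof.
intros NZ; assert (Hz : 0 < Cmod z) by now apply Cmod_gt_0.
exists (Cmod z); split; [exact Hz|]; intros h Hh E.
replace h with (z + h + - z)%C in Hh by ring.
rewrite E, Cplus_0_l, Cmod_opp in Hh; lra.
Qed.

Lemma near0_multiple_small (G : C -> C) (M e : R) :
  near0 (fun h => Cmod (G h) <= M) -> 0 < e -> near0 (fun h => Cmod (h * G h) < e).
Proof.
intros HM He.
(* a strictly positive bound, so that one may divide by it *)
assert (HN : 0 < Rmax M 1) by (apply Rlt_le_trans with 1; [lra|apply Rmax_r]).
assert (Hd : 0 < e / Rmax M 1) by now apply Rdiv_lt_0_compat.
generalize (near0_and _ _ (near0_ball _ Hd) HM); apply near0_imp; intros h [H1 H2].
rewrite Cmod_mult; apply Rle_lt_trans with (Cmod h * Rmax M 1).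
- apply Rmult_le_compat_l; [apply Cmod_ge_0|].
  apply Rle_trans with (1 := H2), Rmax_l.
- apply Rmult_lt_compat_r with (1 := HN) in H1.
  replace (e / Rmax M 1 * Rmax M 1) with e in H1 by (field; lra); exact H1.
Qed.

Definition shift (c : nat -> C) : nat -> C := fun k => c (S k).

(** The Taylor expansion F h = c 0 + c 1 h + ... + c (n-1) h^(n-1) + O(h^n), peeled off
    one coefficient at a time.  The nested remainders turn every calculus rule
    below into a short induction, with no estimate beyond order 0; the entries of [c] from
    [n] on are arbitrary, which lets the rules produce infinite sequences freely. *)
Fixpoint jet (n : nat) (c : nat -> C) (F : C -> C) : Prop :=
  match n with
  | O => exists M : R, near0 (fun h => Cmod (F h) <= M)
  | S m => exists G : C -> C,
      jet m (shift c) G /\ near0 (fun h => F h = c O + h * G h)%C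
  end.

Lemma jet_near (n : nat) : forall (c d : nat -> C) (F H : C -> C),
  (forall k, (k < n)%nat -> c k = d k) ->
  near0 (fun h => F h = H h) -> jet n c F -> jet n d H.
Proof.
induction n as [|n IH]; intros c d F H Hcd HFH.
- intros [M HM]; exists M.
  generalize (near0_and _ _ HFH HM); apply near0_imp.
  intros h [E B]; now rewrite <- E.
- intros [G [JG EG]]; exists G; split.
  + apply IH with (shift c) G; [|now apply near0_all|exact JG].
    intros k Hk; apply Hcd; lia.
  + generalize (near0_and _ _ HFH EG); apply near0_imp.
    intros h [E B]; rewrite <- E, B, (Hcd O); [reflexivity|lia].
Qed.

Lemma jet_bounded (n : nat) : forall (c : nat -> C) (F : C -> C),
  jet n c F -> exists M : R, near0 (fun h => Cmod (F h) <= M).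
Proof.
induction n as [|n IH]; intros c F; [auto|].
intros [G [JG EG]]; destruct (IH _ _ JG) as [M HM].
exists (Cmod (c O) + M).
generalize (near0_and _ _ (near0_ball 1 Rlt_0_1) (near0_and _ _ EG HM)).
apply near0_imp; intros h [H1 [H2 H3]]; rewrite H2.
eapply Rle_trans; [apply Cmod_triangle|]; apply Rplus_le_compat_l.
rewrite Cmod_mult; generalize (Cmod_ge_0 h) (Cmod_ge_0 (G h)); nra.
Qed.

Lemma jet_pred (n : nat) : forall (c : nat -> C) (F : C -> C),
  jet (S n) c F -> jet n c F.
Proof.
induction n as [|n IH]; intros c F J; [now apply jet_bounded with (1 := J)|].
destruct J as [G [JG EG]]; exists G; split; auto.
Qed.

Lemma jet_le (m n : nat) (c : nat -> C) (F : C -> C) :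
  (m <= n)%nat -> jet n c F -> jet m c F.
Proof. induction 1; auto using jet_pred. Qed.

Lemma jet_at0 (n : nat) (c : nat -> C) (F : C -> C) :
  jet (S n) c F -> F (RtoC 0) = c O.
Proof.
intros [G [_ E]]; rewrite (near0_at0 _ E); ring.
Qed.

Lemma jet_const (n : nat) : forall (k : C),
  jet n (fun i => match i with O => k | _ => RtoC 0 end) (fun _ => k).
Proof.
assert (Z : forall m, jet m (fun _ => RtoC 0) (fun _ => RtoC 0)).
{ induction m as [|m IH].
  - exists 0; apply near0_all; intros _; rewrite Cmod_0; lra.
  - exists (fun _ => RtoC 0); split; [exact IH|].
    apply near0_all; intros h; ring. }
intros k; destruct n as [|n].
- exists (Cmod k); apply near0_all; intros _; lra.
- exists (fun _ => RtoC 0); split; [exact (Z n)|].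
  apply near0_all; intros h; ring.
Qed.

Lemma jet_plus (n : nat) : forall (c d : nat -> C) (F G : C -> C),
  jet n c F -> jet n d G ->
  jet n (fun k => c k + d k)%C (fun h => F h + G h)%C.
Proof.
induction n as [|n IH]; intros c d F G.
- intros [M HM] [N HN]; exists (M + N).
  generalize (near0_and _ _ HM HN); apply near0_imp; intros h [H1 H2].
  eapply Rle_trans; [apply Cmod_triangle|lra].
- intros [F' [JF EF]] [G' [JG EG]].
  exists (fun h => F' h + G' h)%C; split.
  + exact (IH _ _ _ _ JF JG).
  + generalize (near0_and _ _ EF EG); apply near0_imp; intros h [-> ->]; ring.
Qed.

Lemma jet_scal (n : nat) (k : C) : forall (c : nat -> C) (F : C -> C),
  jet n c F -> jet n (fun i => k * c i)%C (fun h => k * F h)%C.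
Proof.
induction n as [|n IH]; intros c F.
- intros [M HM]; exists (Cmod k * M); revert HM; apply near0_imp; intros h H.
  rewrite Cmod_mult; apply Rmult_le_compat_l; [apply Cmod_ge_0|exact H].
- intros [F' [JF EF]]; exists (fun h => k * F' h)%C; split.
  + exact (IH _ _ JF).
  + revert EF; apply near0_imp; intros h ->; ring.
Qed.

Fixpoint cauchy_product (c d : nat -> C) (n : nat) : C :=
  match n with
  | O => c O * d O
  | S m => c O * d (S m) + cauchy_product (shift c) d m
  end%C.

(** The recursion of [cauchy_product] mirrors
    F G = (c 0 + h F') (d 0 + h G') = c 0 d 0 + h (c 0 G' + F' G); in the
    remainder, G enters through its jet of one order less ([jet_pred]). *)
Lemma jet_mult (n : nat) : forall (c d : nat -> C) (F G : C -> C),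
  jet n c F -> jet n d G -> jet n (cauchy_product c d) (fun h => F h * G h)%C.
Proof.
induction n as [|n IH]; intros c d F G.
- intros [M HM] [N HN]; exists (M * N).
  generalize (near0_and _ _ HM HN); apply near0_imp; intros h [H1 H2].
  rewrite Cmod_mult; apply Rmult_le_compat; auto using Cmod_ge_0.
- intros [F' [JF EF]] JG; assert (JG' := jet_pred _ _ _ JG).
  destruct JG as [G' [JG EG]].
  exists (fun h => c O * G' h + F' h * G h)%C; split.
  + apply jet_near with (fun k => c O * shift d k + cauchy_product (shift c) d k)%C
      (fun h => c O * G' h + F' h * G h)%C.
    * intros k _; reflexivity.
    * now apply near0_all.
    * apply jet_plus; [now apply jet_scal|now apply IH].
  + generalize (near0_and _ _ EF EG); apply near0_imp; intros h [E1 E2].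
    rewrite E1, E2; cbn [cauchy_product]; ring.
Qed.

(** Since 1/F = 1/(c 0) + h (-1/(c 0)) G (1/F), an n-jet of 1/F gives an (n+1)-jet; the
    induction starts from the boundedness of 1/F. *)
Lemma jet_inv (n : nat) : forall (c : nat -> C) (F : C -> C),
  c O <> RtoC 0 -> jet (S n) c F ->
  exists d, jet (S n) d (fun h => / F h)%C.
Proof.
assert (B : forall (c : nat -> C) (F : C -> C), c O <> RtoC 0 -> jet 1 c F ->
  near0 (fun h => F h <> RtoC 0) /\ exists M, near0 (fun h => Cmod (/ F h)%C <= M)).
{ intros c F Hc [G [[M HM] EG]].
  set (m := Cmod (c O)).
  assert (Hm : 0 < m) by now apply Cmod_gt_0.
  assert (L : near0 (fun h => m / 2 <= Cmod (F h))).
  { assert (Hm2 : 0 < m / 2) by lra.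
    generalize (near0_and _ _ (near0_multiple_small _ _ _ HM Hm2) EG).
    apply near0_imp; intros h [H1 H2].
    assert (T : m <= Cmod (F h) + Cmod (h * G h)).
    { unfold m; replace (c O) with (F h + - (h * G h))%C by (rewrite H2; ring).
      eapply Rle_trans; [apply Cmod_triangle|]; rewrite Cmod_opp; lra. }
    lra. }
  assert (NZ : near0 (fun h => F h <> RtoC 0)).
  { revert L; apply near0_imp; intros h H E; rewrite E, Cmod_0 in H; lra. }
  split; [exact NZ|]; exists (/ (m / 2)).
  generalize (near0_and _ _ L NZ); apply near0_imp; intros h [H1 H2].
  rewrite Cmod_inv by exact H2; apply Rinv_le_contravar; lra. }
induction n as [|n IH]; intros c F Hc J.
- destruct (B c F Hc J) as [NZ [M HM]].
  destruct J as [G [JG EG]].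
  exists (fun i => / c O)%C; exists (fun h => - / c O * (G h * / F h))%C; split.
  + apply jet_near with (fun i => - / c O * cauchy_product (shift c) c i)%C
      (fun h => - / c O * (G h * / F h))%C;
      [intros k Hk; lia|now apply near0_all|].
    apply jet_scal; apply jet_mult with (d := c); [exact JG|].
    exists M; exact HM.
  + generalize (near0_and _ _ NZ EG); apply near0_imp; intros h [H1 H2].
    rewrite H2; rewrite H2 in H1; field; auto.
- destruct (IH c F Hc (jet_pred _ _ _ J)) as [d Jd].
  destruct (B c F Hc (jet_le 1 (S (S n)) _ _ ltac:(lia) J)) as [NZ _].
  destruct J as [G [JG EG]].
  exists (fun i => match i with O => / c O | S j =>
     - / c O * cauchy_product (shift c) d j end)%C.
  exists (fun h => - / c O * (G h * / F h))%C; split.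
  + apply (jet_scal (S n) (- / c O)%C (cauchy_product (shift c) d)).
    now apply jet_mult.
  + generalize (near0_and _ _ NZ EG); apply near0_imp; intros h [H1 H2].
    rewrite H2; rewrite H2 in H1; field; auto.
Qed.

(** With u = h U one has F (u) = c 0 + h U G (u), so the coefficients of a composite
    satisfy a recursion through [cauchy_product].  The recursion calls a whole sequence, hence
    the fuel; fuel [n] gives the right entries below [n]. *)
Fixpoint compose_coef (fuel : nat) (c d : nat -> C) (n : nat) : C :=
  match fuel, n with
  | S m, S k => cauchy_product (shift d) (compose_coef m (shift c) d) k
  | _, _ => c O
  end.

Lemma jet_comp (n : nat) : forall (c d : nat -> C) (F u : C -> C),
  jet n c F -> jet (S n) d u -> d O = RtoC 0 ->
  jet n (compose_coef n c d) (fun h => F (u h)).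
Proof.
induction n as [|n IH]; intros c d F u JF Ju Hd.
all: assert (small : forall P, near0 P -> near0 (fun h => P (u h))).
1,3: intros P [r [Hr HP]]; destruct Ju as [U [JU EU]];
  destruct (jet_bounded _ _ _ JU) as [M HM];
  generalize (near0_and _ _ (near0_multiple_small _ _ _ HM Hr) EU);
  apply near0_imp; intros h [H1 H2]; apply HP; now rewrite H2, Hd, Cplus_0_l.
- destruct JF as [M HM]; exists M; exact (small _ HM).
- assert (Ju' := jet_pred _ _ _ Ju).
  destruct JF as [G [JG EG]]; destruct Ju as [U [JU EU]].
  exists (fun h => U h * G (u h))%C; split.
  + apply (jet_mult n (shift d) (compose_coef n (shift c) d)).
    * now apply jet_pred.
    * now apply IH.
  + generalize (near0_and _ _ EU (small _ EG)); apply near0_imp.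
    intros h [H1 H2]; rewrite H2; cbn [compose_coef]; rewrite H1 at 1.
    rewrite Hd; ring.
Qed.

(** Uniqueness is the tool that reads off coefficient identities, so the two germs are only
    required to agree off the origin: the remainders G of the recursive step are
    determined there only. *)
Lemma jet_unique (n : nat) : forall (c d : nat -> C) (F G : C -> C),
  jet n c F -> jet n d G -> near0 (fun h => h <> RtoC 0 -> F h = G h) ->
  forall k, (k < n)%nat -> c k = d k.
Proof.
induction n as [|n IH]; intros c d F G; [intros; lia|].
intros [F' [JF EF]] [G' [JG EG]] E.
assert (E0 : c O = d O).
{ destruct (jet_bounded _ _ _ JF) as [M HM], (jet_bounded _ _ _ JG) as [N HN].
  cut (c O - d O = RtoC 0)%C.
  { intros Z; replace (c O) with (d O + (c O - d O))%C by ring; rewrite Z; ring. }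
  apply Cmod_eq_0, Rle_antisym; [|apply Cmod_ge_0].
  apply le_epsilon; intros e He; rewrite Rplus_0_l.
  assert (B : near0 (fun h => Cmod (G' h + - F' h) <= N + M)).
  { generalize (near0_and _ _ HN HM); apply near0_imp; intros h [H1 H2].
    eapply Rle_trans; [apply Cmod_triangle|]; rewrite Cmod_opp; lra. }
  destruct (near0_nonzero _ (near0_and _ _ (near0_multiple_small _ _ _ B He)
    (near0_and _ _ E (near0_and _ _ EF EG)))) as [h [NZ [H1 [H2 [H3 H4]]]]].
  specialize (H2 NZ); rewrite H3, H4 in H2.
  replace (c O - d O)%C with (h * (G' h + - F' h))%C; [lra|].
  replace (c O) with (c O + h * F' h - h * F' h)%C by ring; rewrite H2; ring. }
intros [|k] Hk; [exact E0|].
apply (IH (shift c) (shift d) F' G' JF JG); [|lia].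
generalize (near0_and _ _ E (near0_and _ _ EF EG)); apply near0_imp.
intros h [H1 [H2 H3]] NZ; specialize (H1 NZ); rewrite H2, H3, E0 in H1.
replace (F' h) with ((d O + h * F' h - d O) / h)%C by (field; exact NZ).
rewrite H1; field; exact NZ.
Qed.

Lemma jet_div_id (n : nat) (c : nat -> C) (F : C -> C) :
  jet (S (S n)) c F -> c O = RtoC 0 ->
  jet (S n) (shift c)
    (fun h => if Ceq_dec h (RtoC 0) then c 1%nat else F h / h)%C.
Proof.
intros [G [JG EG]] Hc.
assert (G0 := jet_at0 _ _ _ JG).
apply jet_near with (shift c) G; [reflexivity| |exact JG].
revert EG; apply near0_imp; intros h E.
destruct (Ceq_dec h (RtoC 0)) as [->|NZ]; [exact G0|].
rewrite E, Hc; field; exact NZ.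
Qed.

(** * Power series and their derivatives *)

(** Partial sums in Horner form: shifting the coefficients is then definitional, so that
    dividing out z from a series and estimating its partial sums are both
    inductions over [shift]. *)
Fixpoint horner (c : nat -> C) (z : C) (n : nat) : C :=
  match n with
  | O => c O
  | S m => c O + z * horner (shift c) z m
  end%C.

Definition sums_to (c : nat -> C) (z l : C) : Prop :=
  forall e : R, 0 < e -> exists N, forall n, (N <= n)%nat ->
    Cmod (horner c z n - l) < e.

Lemma horner_last (n : nat) : forall (c : nat -> C) (z : C),
  horner c z (S n) = (horner c z n + c (S n) * z ^ S n)%C.
Proof.
induction n as [|n IH]; intros c z; [cbn; unfold shift; ring|].
change (horner c z (S (S n))) with (c O + z * horner (shift c) z (S n))%C.
rewrite IH; unfold shift at 2; cbn; ring.
Qed.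

Lemma is_pseries_sums_to (c : nat -> C) (z l : C) :
  is_pseries c z l -> sums_to c z l.
Proof.
intros H e He.
assert (E : forall n, sum_n (fun k => scal (pow_n z k) (c k)) n = horner c z n).
{ induction n as [|n IH].
  - rewrite sum_O; apply Cmult_1_l.
  - rewrite sum_Sn, IH, horner_last; refine (f_equal (Cplus (horner c z n)) _).
    rewrite (Cmult_comm (c (S n))).
    reflexivity. }
assert (L := proj1 (filterlim_locally_ball_norm _ _) H (mkposreal e He)).
destruct L as [N HN]; exists N; intros n Hn.
assert (K := HN n Hn); revert K.
intros K; change (Cmod (sum_n (fun k => scal (pow_n z k) (c k)) n - l) < e) in K.
now rewrite (E n) in K.
Qed.

Lemma sums_to_shift (c : nat -> C) (z l : C) : z <> RtoC 0 ->
  sums_to c z l -> sums_to (shift c) z ((l - c O) / z).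
Proof.
intros NZ H e He.
assert (Hz : 0 < Cmod z) by now apply Cmod_gt_0.
destruct (H (e * Cmod z)) as [N HN]; [now apply Rmult_lt_0_compat|].
exists N; intros n Hn; specialize (HN (S n) ltac:(lia)); cbn [horner] in HN.
replace (horner (shift c) z n - (l - c O) / z)%C
  with ((c O + z * horner (shift c) z n - l) / z)%C by (field; exact NZ).
rewrite Cmod_div by exact NZ.
apply Rmult_lt_reg_r with (1 := Hz); unfold Rdiv.
now rewrite Rmult_assoc, Rinv_l, Rmult_1_r by lra.
Qed.

Lemma sums_to_0 (c : nat -> C) : sums_to c (RtoC 0) (c O).
Proof.
intros e He; exists O; intros n _.
assert (E : horner c (RtoC 0) n = c O) by (destruct n; cbn; [reflexivity|ring]).
rewrite E; replace (c O - c O)%C with (RtoC 0) by ring; now rewrite Cmod_0.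
Qed.

Lemma sums_to_bound (c : nat -> C) (z l : C) (M : R) :
  (forall n, Cmod (horner c z n) <= M) -> sums_to c z l -> Cmod l <= M.
Proof.
intros HM H; apply le_epsilon; intros e He.
destruct (H e He) as [N HN]; specialize (HN N (le_n N)); specialize (HM N).
replace l with (horner c z N + - (horner c z N - l))%C by ring.
eapply Rle_trans; [apply Cmod_triangle|]; rewrite Cmod_opp; lra.
Qed.

(** Convergence at one point bounds the partial sums, hence their successive differences. *)
Lemma sums_to_coef_bound (c : nat -> C) (z l : C) : sums_to c z l ->
  exists M, 0 <= M /\ forall n, Cmod (c n) * Cmod z ^ n <= M.
Proof.
intros H; destruct (H 1 Rlt_0_1) as [N HN].
assert (B : forall k, exists M, forall n, (n <= k)%nat -> Cmod (horner c z n) <= M).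
{ induction k as [|k [M HM]].
  - exists (Cmod (horner c z O)); intros n Hn; replace n with O by lia; lra.
  - exists (Rmax M (Cmod (horner c z (S k)))); intros n Hn.
    destruct (Nat.eq_dec n (S k)) as [->|D]; [apply Rmax_r|].
    apply Rle_trans with M; [apply HM; lia|apply Rmax_l]. }
destruct (B N) as [M HM]; set (K := Rmax M (Cmod l + 1)).
assert (BK : forall n, Cmod (horner c z n) <= K).
{ intros n; destruct (Compare_dec.le_lt_dec n N) as [L|L].
  - apply Rle_trans with M; [now apply HM|apply Rmax_l].
  - apply Rle_trans with (Cmod l + 1); [|apply Rmax_r].
    replace (horner c z n) with (l + (horner c z n - l))%C by ring.
    eapply Rle_trans; [apply Cmod_triangle|].
    specialize (HN n ltac:(lia)); lra. }
assert (K0 : 0 <= K) by (eapply Rle_trans; [apply Cmod_ge_0|apply (BK O)]).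
exists (2 * K); split; [lra|].
intros [|n].
- specialize (BK O); cbn in BK |- *; lra.
- rewrite <- Cmod_pow, <- Cmod_mult.
  replace (c (S n) * z ^ S n)%C with (horner c z (S n) + - horner c z n)%C
    by (rewrite horner_last; ring).
  eapply Rle_trans; [apply Cmod_triangle|]; rewrite Cmod_opp.
  generalize (BK n) (BK (S n)); lra.
Qed.

Definition geometric (c : nat -> C) (rho M : R) : Prop :=
  forall n, Cmod (c n) * rho ^ n <= M.

Lemma geometric_shift (c : nat -> C) (rho M : R) : 0 < rho ->
  geometric c rho M -> geometric (shift c) rho (M / rho).
Proof.
intros Hr H n; specialize (H (S n)); cbn in H; unfold shift.
apply Rmult_le_reg_r with (1 := Hr); unfold Rdiv.
rewrite (Rmult_assoc M), Rinv_l, Rmult_1_r by lra; lra.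
Qed.

(** With the bound M / rho for the shifted coefficients, the Horner step reads
    M + (rho / 2) (2 M / rho) = 2 M: the bound reproduces itself. *)
Lemma horner_bound (n : nat) : forall (c : nat -> C) (rho M : R) (z : C),
  0 < rho -> geometric c rho M -> Cmod z <= rho / 2 ->
  Cmod (horner c z n) <= 2 * M.
Proof.
induction n as [|n IH]; intros c rho M z Hr H Hz;
  assert (H0 : Cmod (c O) <= M) by (generalize (H O); cbn; lra);
  generalize (Cmod_ge_0 (c O)); intros P; cbn [horner]; [lra|].
eapply Rle_trans; [apply Cmod_triangle|]; rewrite Cmod_mult.
generalize (IH _ _ _ _ Hr (geometric_shift _ _ _ Hr H) Hz); intros B.
assert (Cmod z * Cmod (horner (shift c) z n) <= rho / 2 * (2 * (M / rho)))
  by (apply Rmult_le_compat; auto using Cmod_ge_0).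
replace (rho / 2 * (2 * (M / rho))) with M in H1 by (field; lra); lra.
Qed.

(** Splitting z p - w q as (z - w) p + w (p - q), the Lipschitz constant 4 M / rho
    reproduces itself as the sup bound does. *)
Lemma horner_lipschitz (n : nat) : forall (c : nat -> C) (rho M : R) (z w : C),
  0 < rho -> geometric c rho M -> Cmod z <= rho / 2 -> Cmod w <= rho / 2 ->
  Cmod (horner c z n - horner c w n) <= 4 * M / rho * Cmod (z - w).
Proof.
induction n as [|n IH]; intros c rho M z w Hr H Hz Hw.
- cbn; replace (c O - c O)%C with (RtoC 0) by ring; rewrite Cmod_0.
  assert (0 <= M) by (generalize (H O) (Cmod_ge_0 (c O)); cbn; lra).
  apply Rmult_le_pos; [|apply Cmod_ge_0].
  apply Rmult_le_pos; [lra|]; left; now apply Rinv_0_lt_compat.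
- cbn [horner]; assert (HS := geometric_shift _ _ _ Hr H).
  replace (c O + z * horner (shift c) z n - (c O + w * horner (shift c) w n))%C
    with ((z - w) * horner (shift c) z n +
          w * (horner (shift c) z n - horner (shift c) w n))%C by ring.
  eapply Rle_trans; [apply Cmod_triangle|]; rewrite !Cmod_mult.
  assert (B := horner_bound n _ _ _ z Hr HS Hz).
  assert (L := IH _ _ _ _ _ Hr HS Hz Hw).
  assert (I1 : Cmod (z - w) * Cmod (horner (shift c) z n)
    <= Cmod (z - w) * (2 * (M / rho)))
    by (apply Rmult_le_compat_l; [apply Cmod_ge_0|exact B]).
  assert (I2 : Cmod w * Cmod (horner (shift c) z n - horner (shift c) w n)
    <= rho / 2 * (4 * (M / rho) / rho * Cmod (z - w)))
    by (apply Rmult_le_compat; auto using Cmod_ge_0).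
  replace (4 * M / rho * Cmod (z - w)) with
    (Cmod (z - w) * (2 * (M / rho)) + rho / 2 * (4 * (M / rho) / rho * Cmod (z - w)))
    by (field; lra).
  lra.
Qed.

Definition series_near0 (c : nat -> C) (F : C -> C) : Prop :=
  near0 (fun h => sums_to c h (F h)).

Lemma series_geometric (c : nat -> C) (F : C -> C) : series_near0 c F ->
  exists rho M, 0 < rho /\ geometric c rho M /\
    forall h, Cmod h <= rho / 2 -> sums_to c h (F h).
Proof.
intros [r [Hr H]].
assert (E : Cmod (RtoC (r / 2)) = r / 2) by (rewrite Cmod_R; apply Rabs_pos_eq; lra).
destruct (sums_to_coef_bound c (RtoC (r / 2)) (F (RtoC (r / 2)))) as [M [_ HM]].
{ apply H; rewrite E; lra. }
rewrite E in HM.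
exists (r / 2), M; split; [lra|]; split; [exact HM|].
intros h Hh; apply H; lra.
Qed.

Lemma series_bounded (c : nat -> C) (F : C -> C) : series_near0 c F ->
  exists M, near0 (fun h => Cmod (F h) <= M).
Proof.
intros H; destruct (series_geometric _ _ H) as [rho [M [Hr [HM HS]]]].
exists (2 * M), (rho / 2); split; [lra|]; intros h Hh.
apply sums_to_bound with c h; [|apply HS; lra].
intros n; apply horner_bound with rho; auto; lra.
Qed.

Lemma series_lipschitz (c : nat -> C) (F : C -> C) : series_near0 c F ->
  exists L r, 0 < r /\ forall z w, Cmod z <= r -> Cmod w <= r ->
    Cmod (F z - F w) <= L * Cmod (z - w).
Proof.
intros H; destruct (series_geometric _ _ H) as [rho [M [Hr [HM HS]]]].
exists (4 * M / rho), (rho / 2); split; [lra|]; intros z w Hz Hw.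
apply le_epsilon; intros e He.
destruct (HS z Hz (e / 2)) as [N HN]; [lra|].
destruct (HS w Hw (e / 2)) as [N' HN']; [lra|].
specialize (HN (N + N')%nat ltac:(lia)); specialize (HN' (N + N')%nat ltac:(lia)).
assert (B := horner_lipschitz (N + N') _ _ _ z w Hr HM Hz Hw).
set (p := horner c z (N + N')) in *; set (q := horner c w (N + N')) in *.
replace (F z - F w)%C with ((p - q) + (- (p - F z) + (q - F w)))%C by ring.
eapply Rle_trans; [apply Cmod_triangle|].
generalize (Cmod_triangle (- (p - F z)) (q - F w)); rewrite Cmod_opp; lra.
Qed.

Lemma series_shift (c : nat -> C) (F : C -> C) : series_near0 c F ->
  exists G, series_near0 (shift c) G /\
    near0 (fun h => F h = c O + h * G h)%C.
Proof.
intros H.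
exists (fun h => if Ceq_dec h (RtoC 0) then c 1%nat else ((F h - c O) / h)%C); split.
- revert H; apply near0_imp; intros h H.
  destruct (Ceq_dec h (RtoC 0)) as [->|NZ].
  + exact (sums_to_0 (shift c)).
  + now apply sums_to_shift.
- assert (F0 : F (RtoC 0) = c O).
  { assert (H0 := near0_at0 _ H).
    cut (F (RtoC 0) - c O = RtoC 0)%C.
    { intros Z; replace (F (RtoC 0)) with (F (RtoC 0) - c O + c O)%C by ring.
      rewrite Z; ring. }
    apply Cmod_eq_0, Rle_antisym; [|apply Cmod_ge_0].
    apply le_epsilon; intros e He.
    destruct (H0 e He) as [N HN], (sums_to_0 c e He) as [N' _].
    specialize (HN (S N) ltac:(lia)); cbn [horner] in HN.
    rewrite <- Cmod_opp.
    replace (- (F (RtoC 0) - c O))%C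
      with (c O + RtoC 0 * horner (shift c) (RtoC 0) N - F (RtoC 0))%C by ring.
    lra. }
  apply near0_all; intros h.
  destruct (Ceq_dec h (RtoC 0)) as [->|NZ]; [rewrite F0; ring|field; exact NZ].
Qed.

Lemma series_jet (n : nat) : forall (c : nat -> C) (F : C -> C),
  series_near0 c F -> jet n c F.
Proof.
induction n as [|n IH]; intros c F H; [now apply series_bounded with c|].
destruct (series_shift _ _ H) as [G [HG EG]]; exists G; auto.
Qed.

(** [D] agrees near the origin with the derivative of [F], read off from second jets; this
    form can be transported through the algebraic operations on jets. *)
Definition derivative_near0 (F D : C -> C) : Prop :=
  near0 (fun z => exists c, jet 2 c (fun h => F (z + h)%C) /\ c 1%nat = D z).

Lemma jet2_derivative_bound (c : nat -> C) (F : C -> C) (L : R) :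
  jet 2 c F -> near0 (fun h => Cmod (F h - F (RtoC 0)) <= L * Cmod h) ->
  Cmod (c 1%nat) <= L.
Proof.
intros J H; assert (F0 := jet_at0 _ _ _ J).
destruct J as [G [[G' [[M HM] EG']] EG]].
apply le_epsilon; intros e He.
destruct (near0_nonzero _ (near0_and _ _ H (near0_and _ _
  (near0_multiple_small _ _ _ HM He) (near0_and _ _ EG EG'))))
  as [h [NZ [K1 [K2 [K3 K4]]]]].
replace (c 1%nat) with ((F h - F (RtoC 0)) / h + - (h * G' h))%C.
2:{ rewrite K3, K4, F0; unfold shift; field; exact NZ. }
eapply Rle_trans; [apply Cmod_triangle|].
rewrite Cmod_opp, Cmod_div by exact NZ; apply Cmod_gt_0 in NZ.
assert (Cmod (F h - F (RtoC 0)) / Cmod h <= L); [|lra].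
apply Rmult_le_reg_r with (1 := NZ); unfold Rdiv.
now rewrite Rmult_assoc, Rinv_l, Rmult_1_r by lra.
Qed.

Lemma derivative_bounded (c : nat -> C) (F D : C -> C) :
  series_near0 c F -> derivative_near0 F D ->
  exists M, near0 (fun h => Cmod (D h) <= M).
Proof.
intros HF HD; destruct (series_lipschitz _ _ HF) as [L [r [Hr HL]]].
exists L.
assert (Hr2 : 0 < r / 2) by lra.
generalize (near0_and _ _ (near0_ball _ Hr2) HD); apply near0_imp.
intros z [Hz [d [Jd <-]]].
apply (jet2_derivative_bound _ _ _ Jd).
exists (r / 2); split; [lra|]; intros h Hh.
replace (L * Cmod h) with (L * Cmod (z + h - (z + RtoC 0)))
  by (f_equal; f_equal; ring).
apply HL; eapply Rle_trans; try apply Cmod_triangle; try lra.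
rewrite Cmod_0; lra.
Qed.

Definition jet_X (z : C) (k : nat) : C :=
  match k with O => z | 1%nat => RtoC 1 | _ => RtoC 0 end.

Lemma jet_translation (n : nat) (z : C) : jet n (jet_X z) (fun h => z + h)%C.
Proof.
destruct n as [|n].
- exists (Cmod z + 1); exists 1; split; [lra|]; intros h Hh.
  eapply Rle_trans; [apply Cmod_triangle|lra].
- exists (fun _ => RtoC 1); split.
  + apply jet_near with (2 := near0_all _ (fun h => eq_refl)) (3 := jet_const n (RtoC 1)).
    intros [|k] _; reflexivity.
  + apply near0_all; intros h; cbn; ring.
Qed.

(** From F = c 0 + h G one gets D = G + h G'.  Away from the origin G is a quotient of
    germs having jets; at the origin its own jet is used. *)
Lemma derivative_shift (c : nat -> C) (F G D : C -> C) :
  derivative_near0 F D ->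
  near0 (fun h => F h = c O + h * G h)%C -> jet 2 (shift c) G ->
  exists DG, derivative_near0 G DG /\ near0 (fun h => D h = G h + h * DG h)%C.
Proof.
intros HD EG JG.
assert (EF0 := near0_at0 _ EG).
exists (fun z => if Ceq_dec z (RtoC 0) then c 2%nat else ((D z - G z) / z)%C); split.
- generalize (near0_and _ _ HD (near0_translate _ EG)); apply near0_imp.
  intros z [[d [Jd Ed]] Ez]; destruct (Ceq_dec z (RtoC 0)) as [->|NZ].
  + exists (shift c); split; [|reflexivity].
    apply jet_near with (3 := JG); [reflexivity|].
    apply near0_all; intros h; f_equal; ring.
  + destruct (jet_inv 1 _ _ NZ (jet_translation 2 z)) as [i Ji].
    set (e := cauchy_product (fun k : nat => d k + match k with O => - c O | _ => RtoC 0 end)%C i).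
    assert (Je : jet 2 e (fun h => G (z + h)%C)).
    { apply jet_near with e (fun h => (F (z + h) + - c O) * / (z + h))%C; [reflexivity| |].
      - assert (Hz : 0 < Cmod z) by now apply Cmod_gt_0.
        generalize (near0_and _ _ Ez (near0_ball _ Hz)); apply near0_imp.
        intros h [Eh Hh]; rewrite Eh; field.
        intros Z; replace h with (- z)%C in Hh.
        + rewrite Cmod_opp in Hh; lra.
        + replace h with (z + h - z)%C by ring; rewrite Z; ring.
      - apply jet_mult; [|exact Ji].
        exact (jet_plus 2 _ _ _ _ Jd (jet_const 2 (- c O)%C)). }
    exists e; split; [exact Je|].
    assert (E0 := jet_at0 _ _ _ Je); cbn beta in E0; rewrite Cplus_0_r in E0.
    assert (JF := jet_plus _ _ _ _ _ (jet_const 2 (c O))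
                    (jet_mult _ _ _ _ _ (jet_translation 2 z) Je)).
    assert (U : d 1%nat = (RtoC 0 + (z * e 1%nat + RtoC 1 * e O))%C).
    { refine (jet_unique 2 _ _ _ _ Jd JF _ 1%nat _); [|lia].
      revert Ez; apply near0_imp; intros h Eh _; exact Eh. }
    rewrite <- Ed, U, E0; field; exact NZ.
- generalize (near0_and _ _ HD (near0_translate _ EG)); apply near0_imp.
  intros z [[d [Jd Ed]] Ez]; destruct (Ceq_dec z (RtoC 0)) as [->|NZ];
    [|field; exact NZ].
  rewrite <- Ed, Cmult_0_l, Cplus_0_r, (jet_at0 _ _ _ JG).
  assert (JF : jet 2 c F) by (exists G; split; [now apply jet_pred|exact EG]).
  refine (jet_unique 2 _ _ _ _ Jd JF _ 1%nat _); [|lia].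
  apply near0_all; intros h _; f_equal; ring.
Qed.

(** Term-by-term differentiation.  By induction on the order, D = G + h G' for
    F = c 0 + h G, and the jets of G' are provided by the induction hypothesis applied to the
    shifted series; the base case is the Lipschitz bound, so no series of derivatives has to be
    summed. *)
Lemma derivative_jet (n : nat) : forall (c : nat -> C) (F D : C -> C),
  series_near0 c F -> derivative_near0 F D ->
  jet n (fun k => INR (S k) * c (S k))%C D.
Proof.
induction n as [|n IH]; intros c F D HF HD; [exact (derivative_bounded c F D HF HD)|].
destruct (series_shift _ _ HF) as [G [HG EG]].
destruct (series_shift _ _ HG) as [G2 [HG2 EG2]].
destruct (derivative_shift _ _ _ _ HD EG (series_jet 2 _ _ HG)) as [DG [HDG ED]].
exists (fun h => G2 h + DG h)%C; split.
- apply jet_near with (2 := near0_all _ (fun h => eq_refl))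
    (3 := jet_plus _ _ _ _ _ (series_jet n _ _ HG2) (IH _ _ _ HG HDG)).
  intros k _; unfold shift; rewrite (S_INR (S k)), RtoC_plus; ring.
- generalize (near0_and _ _ ED EG2); apply near0_imp; intros h [-> ->].
  unfold shift; cbn [INR]; ring.
Qed.

Lemma jet2_C_derive (c : nat -> C) (F : C -> C) (z : C) :
  jet 2 c (fun h => F (z + h)%C) -> C_derive F z = c 1%nat.
Proof.
intros J; apply is_C_derive_unique; split; [apply is_linear_scal_l|].
intros x Hx; assert (Ex := is_filter_lim_locally_unique (V := AbsRing_NormedModule C_AbsRing) z x Hx); subst x.
intros e.
assert (F0 := jet_at0 _ _ _ J); cbn beta in F0; rewrite Cplus_0_r in F0.
destruct J as [G [[G' [[M HM] EG']] EG]].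
destruct (near0_and _ _ (near0_multiple_small _ _ _ HM (cond_pos e)) (near0_and _ _ EG EG'))
  as [r [Hr K]].
exists (mkposreal r Hr); intros y Hy; change C in (type of y).
change (Cmod (y - z) < r) in Hy.
change (Cmod ((F y - F z) - (y - z) * c 1%nat) <= e * Cmod (y - z)).
destruct (K _ Hy) as [K1 [K2 K3]].
replace (z + (y - z))%C with y in K2 by ring.
rewrite K2, K3, F0.
replace (c O + (y - z) * (shift c O + (y - z) * G' (y - z)) - c O - (y - z) * c 1%nat)%C
  with ((y - z) * G' (y - z) * (y - z))%C by (unfold shift; ring).
rewrite Cmod_mult; apply Rmult_le_compat_r; [apply Cmod_ge_0|lra].
Qed.

(** * The maximum principle *)

(** Compactness as a transfer of a local estimate to a uniform one, with [d] serving both as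
    radius and as estimate. *)
Lemma disk_compact (r : R) (Q : C -> R -> Prop) :
  (forall w d e, 0 < d -> d <= e -> Q w e -> Q w d) ->
  (forall z, Cmod z <= r -> exists d, 0 < d /\
     forall w, Cmod w <= r -> Cmod (w - z) < d -> Q w d) ->
  exists d, 0 < d /\ forall w, Cmod w <= r -> Q w d.
Proof.
intros Hmono Hloc.
assert (H : forall z, exists d : posreal,
  forall w, Cmod w <= r -> Cmod (w - z) < 2 * d -> Q w d).
{ intros z; destruct (Rle_lt_dec (Cmod z) r) as [L|L].
  - destruct (Hloc z L) as [d [Hd Hw]].
    assert (Hd2 : 0 < d / 2) by lra.
    exists (mkposreal _ Hd2); cbn; intros w H1 H2.
    apply Hmono with d; [lra|lra|]; apply Hw; lra.
  - assert (Hd : 0 < (Cmod z - r) / 2) by lra.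
    exists (mkposreal _ Hd); cbn; intros w H1 H2; exfalso.
    assert (T : Cmod z <= Cmod w + Cmod (w - z)).
    { replace z with (w + - (w - z))%C at 1 by ring.
      eapply Rle_trans; [apply Cmod_triangle|]; rewrite Cmod_opp; lra. }
    lra. }
set (delta := fun z => proj1_sig (constructive_indefinite_description _ (H z))).
assert (Hdelta : forall z w, Cmod w <= r -> Cmod (w - z) < 2 * delta z -> Q w (delta z)).
{ intros z; unfold delta; now destruct (constructive_indefinite_description _ (H z)). }
destruct (compactness_value_2d (- r) r (- r) r (fun x y => delta (x, y))) as [d Hd].
exists d; split; [apply cond_pos|]; intros w Hw.
assert (X := Rle_trans _ _ _ (Rmax_Cmod w) Hw).
assert (X1 := Rle_trans _ _ _ (Rmax_l _ _) X).
assert (X2 := Rle_trans _ _ _ (Rmax_r _ _) X).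
apply Rabs_le_between in X1; apply Rabs_le_between in X2.
destruct (NNPP _ (Hd (fst w) (snd w) X1 X2)) as [u [v [_ [_ [U [V D]]]]]].
apply Hmono with (1 := cond_pos d) (2 := D); apply Hdelta; [exact Hw|].
eapply Rle_lt_trans; [apply Cmod_2Rmax|].
assert (S2 : 0 <= sqrt 2 <= 2).
{ split; [apply sqrt_pos|]; apply Rsqr_incr_0_var; [|lra].
  rewrite Rsqr_sqrt; unfold Rsqr; lra. }
assert (B : Rmax (Rabs (fst (w - (u, v))%C)) (Rabs (snd (w - (u, v))%C)) < delta (u, v))
  by (apply Rmax_lub_lt; assumption).
generalize (Rle_trans _ _ _ (Rabs_pos (fst (w - (u, v))%C)) (Rmax_l _ (Rabs (snd (w - (u, v))%C)))).
intros P; apply Rle_lt_trans with (2 * Rmax (Rabs (fst (w - (u, v))%C)) (Rabs (snd (w - (u, v))%C))).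
- apply Rmult_le_compat_r; lra.
- lra.
Qed.

(** Both the boundedness and the attainment of the supremum are instances of
    [disk_compact], for the estimates Psi <= 1/d and Psi <= S - d. *)
Lemma disk_maximum (r : R) (Psi : C -> R) : 0 <= r ->
  (forall z e, Cmod z <= r -> 0 < e -> exists d, 0 < d /\
     forall w, Cmod (w - z) < d -> Rabs (Psi w - Psi z) < e) ->
  exists z, Cmod z <= r /\ forall w, Cmod w <= r -> Psi w <= Psi z.
Proof.
intros Hr Hc.
destruct (disk_compact r (fun w d => Psi w <= / d)) as [b [Hb HB]].
{ intros w d e Hd Hde H; apply Rle_trans with (1 := H).
  now apply Rinv_le_contravar. }
{ intros z Hz; destruct (Hc z 1 Hz Rlt_0_1) as [d [Hd H]].
  assert (P : 0 < Rabs (Psi z) + 1) by (generalize (Rabs_pos (Psi z)); lra).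
  exists (Rmin d (/ (Rabs (Psi z) + 1))); split.
  { apply Rmin_pos; [lra|now apply Rinv_0_lt_compat]. }
  intros w _ Hw.
  assert (D := H w (Rlt_le_trans _ _ _ Hw (Rmin_l _ _))).
  apply Rabs_lt_between in D.
  apply Rle_trans with (Rabs (Psi z) + 1).
  - generalize (Rle_abs (Psi z)); lra.
  - rewrite <- (Rinv_inv (Rabs (Psi z) + 1)) at 1.
    apply Rinv_le_contravar; [|apply Rmin_r].
    apply Rmin_pos; [lra|now apply Rinv_0_lt_compat]. }
set (E := fun y => exists w, Cmod w <= r /\ y = Psi w).
destruct (completeness E) as [S [US LS]].
{ exists (/ b); intros y [w [Hw ->]]; now apply HB. }
{ exists (Psi (RtoC 0)), (RtoC 0); rewrite Cmod_0; auto. }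
apply NNPP; intros N.
(* were the supremum not attained, it would be missed uniformly *)
destruct (disk_compact r (fun w d => Psi w <= S - d)) as [d [Hd HD]].
{ intros w d e Hd Hde H; lra. }
{ intros z Hz.
  assert (L : Psi z < S).
  { destruct (Rle_lt_or_eq_dec (Psi z) S) as [L|L]; [apply US; now exists z|exact L|].
    exfalso; apply N; exists z; split; [exact Hz|].
    intros w Hw; rewrite L; apply US; now exists w. }
  assert (L2 : 0 < (S - Psi z) / 2) by lra.
  destruct (Hc z _ Hz L2) as [d [Hd H]].
  exists (Rmin d ((S - Psi z) / 2)); split; [now apply Rmin_pos|].
  intros w _ Hw.
  assert (D := H w (Rlt_le_trans _ _ _ Hw (Rmin_l _ _))).
  apply Rabs_lt_between in D.
  generalize (Rmin_r d ((S - Psi z) / 2)); lra. }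
assert (S <= S - d); [|lra].
apply LS; intros y [w [Hw ->]]; now apply HD.
Qed.

Lemma Cmod_axes (t : R) : 0 <= t ->
  Cmod (t, 0) = t /\ Cmod (- t, 0) = t /\ Cmod (0, t) = t /\ Cmod (0, - t) = t.
Proof.
intros Ht; unfold Cmod; cbn [fst snd].
repeat split; (transitivity (sqrt (t ^ 2)); [f_equal; ring|now apply sqrt_pow2]).
Qed.

(** Over the four points t, -t, it, -it the sums of h and of h^2 vanish, so the mean of |F|^2
    is |c 0|^2 + |c 1|^2 t^2 + O(t^3), while the linear term on the right averages to 0.  This is the
    discrete form of the identity Laplacian |F|^2 = 4 |F'|^2; it needs only a jet at one point. *)
Lemma four_point_mean (c : nat -> C) (F : C -> C) (beta : C) (K : R) :
  jet 3 c F ->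
  near0 (fun h => Cmod (F h) ^ 2 <= Cmod (c O) ^ 2 + Re (beta * h) + K * Cmod h ^ 2) ->
  Cmod (c 1%nat) ^ 2 <= K.
Proof.
intros [G [[G' [[G'' [[M HM] E3]] E2]] E1]] H.
set (c0 := c O) in *; set (c1 := c 1%nat) in *; set (c2 := c 2%nat).
set (A := Cmod c0 + Cmod c1 + Cmod c2).
set (P := fun h => (c0 + c1 * h + c2 * h * h)%C).
assert (A0 : 0 <= A) by
  (unfold A; generalize (Cmod_ge_0 c0) (Cmod_ge_0 c1) (Cmod_ge_0 c2); lra).
set (N := Rmax M 0).
assert (N0 : 0 <= N) by apply Rmax_r.
assert (L : near0 (fun h => Cmod (P h) ^ 2 - 2 * A * N * Cmod h ^ 3 <=
   Cmod c0 ^ 2 + Re (beta * h) + K * Cmod h ^ 2)).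
{ generalize (near0_and _ _ (near0_and _ _ H (near0_ball 1 Rlt_0_1))
    (near0_and _ _ HM (near0_and _ _ E1 (near0_and _ _ E2 E3)))).
  apply near0_imp; intros h [[H1 H2] [H3 [H4 [H5 H6]]]].
  apply Rle_trans with (2 := H1).
  set (E := (h * h * h * G'' h)%C).
  assert (EF : F h = (P h + E)%C).
  { rewrite H4, H5, H6; unfold P, E, c0, c1, c2, shift; ring. }
  assert (BE : Cmod E <= N * Cmod h ^ 3).
  { unfold E; rewrite !Cmod_mult.
    replace (Cmod h * Cmod h * Cmod h * Cmod (G'' h))
      with (Cmod (G'' h) * Cmod h ^ 3) by ring.
    apply Rmult_le_compat_r; [apply pow_le, Cmod_ge_0|].
    apply Rle_trans with (1 := H3), Rmax_l. }
  assert (BP : Cmod (P h) <= A).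
  { unfold P, A; eapply Rle_trans; [apply Cmod_triangle|].
    apply Rplus_le_compat.
    - eapply Rle_trans; [apply Cmod_triangle|]; rewrite Cmod_mult.
      generalize (Cmod_ge_0 c1) (Cmod_ge_0 h); nra.
    - rewrite !Cmod_mult; generalize (Cmod_ge_0 c2) (Cmod_ge_0 h); intros.
      assert (Cmod h * Cmod h <= 1) by nra. nra. }
  assert (T : Cmod (P h) <= Cmod (F h) + Cmod E).
  { replace (P h) with (F h + - E)%C by (rewrite EF; ring).
    eapply Rle_trans; [apply Cmod_triangle|]; rewrite Cmod_opp; lra. }
  generalize (Cmod_ge_0 (P h)) (Cmod_ge_0 E) (Cmod_ge_0 (F h)); intros.
  assert (Q : Cmod (P h) * Cmod E <= A * (N * Cmod h ^ 3))
    by (apply Rmult_le_compat; assumption).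
  assert (Cmod (P h) ^ 2 - 2 * (Cmod (P h) * Cmod E) <= Cmod (F h) ^ 2).
  { destruct (Rle_lt_dec (Cmod E) (Cmod (P h))); nra. }
  lra. }
destruct L as [r [Hr L]].
apply le_epsilon; intros e He.
assert (HB : 0 < 2 * A * N + 1) by nra.
set (t := Rmin (r / 2) (e / (2 * A * N + 1))).
assert (Ht : 0 < t) by (apply Rmin_pos; [lra|now apply Rdiv_lt_0_compat]).
assert (T1 : t <= r / 2) by apply Rmin_l.
assert (T2 : 2 * A * N * t <= e).
{ assert (t * (2 * A * N + 1) <= e / (2 * A * N + 1) * (2 * A * N + 1))
    by (apply Rmult_le_compat_r; [lra|apply Rmin_r]).
  replace (e / (2 * A * N + 1) * (2 * A * N + 1)) with e in H0 by (field; lra).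
  lra. }
destruct (Cmod_axes t (Rlt_le _ _ Ht)) as [M1 [M2 [M3 M4]]].
assert (I1 := L (t, 0) ltac:(lra)); assert (I2 := L (- t, 0) ltac:(lra)).
assert (I3 := L (0, t) ltac:(lra)); assert (I4 := L (0, - t) ltac:(lra)).
rewrite M1 in I1; rewrite M2 in I2; rewrite M3 in I3; rewrite M4 in I4.
(* the quartic identity that makes the cross terms cancel *)
assert (S : Cmod (P (t, 0%R)) ^ 2 + Cmod (P (- t, 0)%R) ^ 2 + Cmod (P (0, t)%R) ^ 2
   + Cmod (P (0, - t)%R) ^ 2
   = 4 * (Cmod c0 ^ 2 + Cmod c1 ^ 2 * t ^ 2 + Cmod c2 ^ 2 * t ^ 4)).
{ rewrite !Cmod2_alt; unfold P, Re, Im; cbn; ring. }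
assert (SB : Re (beta * (t, 0%R)) + Re (beta * (- t, 0)%R) + Re (beta * (0, t)%R)
   + Re (beta * (0, - t)%R) = 0).
{ unfold Re; cbn; ring. }
assert (0 <= Cmod c2 ^ 2 * t ^ 4).
{ apply Rmult_le_pos; apply pow_le; [apply Cmod_ge_0|lra]. }
assert (Z : Cmod c1 ^ 2 * t ^ 2 <= (K + 2 * A * N * t) * t ^ 2) by nra.
apply Rmult_le_reg_r in Z; [lra|apply pow_lt, Ht].
Qed.

(** Functions with jets of every order at every point of the disk.  They form a class
    closed under the quotients and Moebius transforms below by the calculus of jets, and
    [four_point_mean] applies to it. *)
Definition holomorphic (F : C -> C) : Prop :=
  forall z n, unit_disk z -> exists c, jet n c (fun h => F (z + h)%C).

Lemma jet_continuous (c : nat -> C) (F : C -> C) (z : C) (e : R) :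
  jet 1 c (fun h => F (z + h)%C) -> 0 < e ->
  exists d, 0 < d /\ forall w, Cmod (w - z) < d -> Cmod (F w - F z) < e.
Proof.
intros J He; assert (F0 := jet_at0 _ _ _ J); cbn beta in F0; rewrite Cplus_0_r in F0.
destruct J as [G [[M HM] EG]].
destruct (near0_and _ _ (near0_multiple_small _ _ _ HM He) EG) as [d [Hd K]].
exists d; split; [exact Hd|]; intros w Hw.
destruct (K _ Hw) as [K1 K2].
replace (z + (w - z))%C with w in K2 by ring; rewrite K2, F0.
now replace (c O + (w - z) * G (w - z) - c O)%C with ((w - z) * G (w - z))%C by ring.
Qed.

Lemma Cmod_sqr_continuous (z : C) (e : R) : 0 < e ->
  exists d, 0 < d /\ forall w, Cmod (w - z) < d -> Rabs (Cmod w ^ 2 - Cmod z ^ 2) < e.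
Proof.
intros He; generalize (Cmod_ge_0 z); intros Hz.
assert (Hq : 0 < e / (2 * Cmod z + 1)) by (apply Rdiv_lt_0_compat; lra).
exists (Rmin 1 (e / (2 * Cmod z + 1))); split; [now apply Rmin_pos; [lra|]|].
intros w Hw.
assert (H1 := Rlt_le_trans _ _ _ Hw (Rmin_l _ _)).
assert (H2 := Rlt_le_trans _ _ _ Hw (Rmin_r _ _)).
apply Rmult_lt_compat_r with (r := 2 * Cmod z + 1) in H2; [|lra].
replace (e / (2 * Cmod z + 1) * (2 * Cmod z + 1)) with e in H2 by (field; lra).
assert (T1 : Cmod w <= Cmod z + Cmod (w - z)).
{ replace w with (z + (w - z))%C at 1 by ring; apply Cmod_triangle. }
assert (T2 : Cmod z <= Cmod w + Cmod (w - z)).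
{ replace z with (w + - (w - z))%C at 1 by ring.
  eapply Rle_trans; [apply Cmod_triangle|]; rewrite Cmod_opp; lra. }
generalize (Cmod_ge_0 w) (Cmod_ge_0 (w - z)); intros.
apply Rabs_lt_between; split; nra.
Qed.

(** The function |F|^2 + e |z|^2 has no interior local maximum: at such a point p,
    [four_point_mean] would give |F'(p)|^2 <= - e.  So its maximum, which exists by compactness,
    lies on the circle; then e tends to 0. *)
Lemma maximum_principle (F : C -> C) (r B : R) :
  holomorphic F -> 0 <= r < 1 -> 0 <= B ->
  (forall z, Cmod z = r -> Cmod (F z) <= B) ->
  forall z, Cmod z <= r -> Cmod (F z) <= B.
Proof.
intros HF [Hr0 Hr1] HB Hbd z Hz.
apply Rsqr_incr_0_var; [|exact HB]; rewrite !Rsqr_pow2.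
apply le_epsilon; intros e He.
set (Psi := fun w => Cmod (F w) ^ 2 + e * Cmod w ^ 2).
destruct (disk_maximum r Psi Hr0) as [p [Hp Hmax]].
{ intros w e' Hw He'.
  destruct (HF w 1%nat) as [c J]; [unfold unit_disk; lra|].
  assert (He2 : 0 < e' / 2) by lra.
  assert (Hee : 0 < e' / 2 / e) by (now apply Rdiv_lt_0_compat).
  destruct (Cmod_sqr_continuous (F w) _ He2) as [d1 [D1 K1]].
  destruct (jet_continuous _ _ _ _ J D1) as [d2 [D2 K2]].
  destruct (Cmod_sqr_continuous w _ Hee) as [d3 [D3 K3]].
  exists (Rmin d2 d3); split; [now apply Rmin_pos|]; intros v Hv.
  assert (V1 := K1 _ (K2 _ (Rlt_le_trans _ _ _ Hv (Rmin_l _ _)))).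
  assert (V2 := K3 _ (Rlt_le_trans _ _ _ Hv (Rmin_r _ _))).
  unfold Psi.
  replace (Cmod (F v) ^ 2 + e * Cmod v ^ 2 - (Cmod (F w) ^ 2 + e * Cmod w ^ 2))
    with (Cmod (F v) ^ 2 - Cmod (F w) ^ 2 + e * (Cmod v ^ 2 - Cmod w ^ 2)) by ring.
  eapply Rle_lt_trans; [apply Rabs_triang|].
  rewrite Rabs_mult, (Rabs_pos_eq e) by lra.
  apply Rmult_lt_compat_l with (1 := He) in V2.
  replace (e * (e' / 2 / e)) with (e' / 2) in V2 by (field; lra); lra. }
assert (Er : Cmod p = r).
{ apply Rle_antisym; [exact Hp|]; apply Rnot_lt_le; intros L; exfalso.
  destruct (HF p 3%nat) as [c J]; [unfold unit_disk; lra|].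
  assert (c0 := jet_at0 _ _ _ J); cbn beta in c0; rewrite Cplus_0_r in c0.
  cut (Cmod (c 1%nat) ^ 2 <= - e); [generalize (pow2_ge_0 (Cmod (c 1%nat))); lra|].
  apply (four_point_mean c (fun h => F (p + h)%C) (- (2 * e) * Cconj p)%C _ J).
  exists (r - Cmod p); split; [lra|]; intros h Hh.
  assert (I : Psi (p + h)%C <= Psi p).
  { apply Hmax; eapply Rle_trans; [apply Cmod_triangle|lra]. }
  unfold Psi in I; rewrite <- c0.
  assert (X : Cmod (p + h) ^ 2 = Cmod p ^ 2 + 2 * Re (Cconj p * h) + Cmod h ^ 2)
    by (rewrite !Cmod2_alt; unfold Re, Im; cbn; ring).
  assert (Y : Re (- (2 * e) * Cconj p * h) = - (2 * e) * Re (Cconj p * h))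
    by (unfold Re; cbn; ring).
  rewrite Y; rewrite X in I; nra. }
assert (I := Hmax z Hz); assert (J := Hbd p Er); unfold Psi in I.
assert (Cmod (F p) ^ 2 <= B ^ 2) by (apply pow_incr; split; [apply Cmod_ge_0|exact J]).
generalize (pow2_ge_0 (Cmod z)); intros P.
assert (Cmod p ^ 2 <= 1) by (rewrite Er; nra).
nra.
Qed.

(** * The Schwarz lemma and its second-order form *)

Lemma analytic_series (F : C -> C) (z : C) : analytic_on_disk F -> unit_disk z ->
  exists c, series_near0 c (fun h => F (z + h)%C).
Proof.
intros HF Hz; destruct (HF z Hz) as [c [r [Hr H]]]; exists c, r; split; [exact Hr|].
intros h Hh; now apply is_pseries_sums_to, H.
Qed.

Lemma analytic_holomorphic (F : C -> C) : analytic_on_disk F -> holomorphic F.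
Proof.
intros HF z n Hz; destruct (analytic_series F z HF Hz) as [c H].
exists c; now apply series_jet.
Qed.

Lemma holomorphic_jet0 (F : C -> C) (n : nat) : holomorphic F -> exists c, jet n c F.
Proof.
intros HF; destruct (HF (RtoC 0) n) as [c J].
- unfold unit_disk; rewrite Cmod_0; lra.
- exists c; apply jet_near with (3 := J); [reflexivity|].
  apply near0_all; intros h; f_equal; ring.
Qed.

Definition div_id (k : C) (F : C -> C) (z : C) : C :=
  if Ceq_dec z (RtoC 0) then k else (F z / z)%C.

Lemma holomorphic_div_id (c : nat -> C) (F : C -> C) :
  holomorphic F -> jet 2 c F -> c O = RtoC 0 -> holomorphic (div_id (c 1%nat) F).
Proof.
intros HF JF Hc z n Hz; destruct (Ceq_dec z (RtoC 0)) as [->|NZ].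
- destruct (holomorphic_jet0 F (S (S n)) HF) as [d J].
  assert (U : forall k, (k < 2)%nat -> d k = c k).
  { apply (jet_unique 2 d c F F); [apply jet_le with (2 := J); lia|exact JF|].
    now apply near0_all. }
  exists (shift d); apply jet_pred, jet_near
    with (3 := jet_div_id n d F J (eq_trans (U O ltac:(lia)) Hc)); [reflexivity|].
  apply near0_all; intros h; unfold div_id.
  rewrite <- (U 1%nat ltac:(lia)), Cplus_0_l; reflexivity.
- destruct (HF z (S n) Hz) as [d J].
  destruct (jet_inv n _ _ NZ (jet_translation (S n) z)) as [i Ji].
  exists (cauchy_product d i); apply jet_pred, jet_near with (3 := jet_mult _ _ _ _ _ J Ji);
    [reflexivity|].
  generalize (near0_translate_neq0 z NZ); apply near0_imp; intros h E; unfold div_id.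
  destruct (Ceq_dec (z + h) (RtoC 0)); [contradiction|reflexivity].
Qed.

Lemma holomorphic_affine (F : C -> C) (p q : C) :
  holomorphic F -> holomorphic (fun z => p + q * F z)%C.
Proof.
intros HF z n Hz; destruct (HF z n Hz) as [c J].
eexists; exact (jet_plus _ _ _ _ _ (jet_const n p) (jet_scal n q _ _ J)).
Qed.

Lemma holomorphic_quotient (F G : C -> C) : holomorphic F -> holomorphic G ->
  (forall z, unit_disk z -> G z <> RtoC 0) -> holomorphic (fun z => F z * / G z)%C.
Proof.
intros HF HG NZ z n Hz; destruct (HF z (S n) Hz) as [c J], (HG z (S n) Hz) as [d K].
assert (E := jet_at0 _ _ _ K); cbn beta in E; rewrite Cplus_0_r in E.
destruct (jet_inv n d (fun h => G (z + h)%C)) as [i Ki]; [rewrite <- E; auto|exact K|].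
exists (cauchy_product c i); now apply jet_pred, jet_mult.
Qed.

(** The Schwarz lemma: |F(z)/z| <= 1/r on each circle |z| = r, and r tends to 1. *)
Lemma schwarz_quotient (c : nat -> C) (F : C -> C) :
  holomorphic F -> jet 2 c F -> c O = RtoC 0 ->
  (forall z, unit_disk z -> Cmod (F z) <= 1) ->
  forall z, unit_disk z -> Cmod (div_id (c 1%nat) F z) <= 1.
Proof.
intros HF JF Hc HB z Hz; unfold unit_disk in Hz.
assert (HQ := holomorphic_div_id _ _ HF JF Hc).
apply Rnot_lt_le; intros L.
set (q := Cmod (div_id (c 1%nat) F z)) in *.
assert (Hq : / q < 1) by (rewrite <- Rinv_1; apply Rinv_lt_contravar; lra).
assert (Hq0 : 0 < / q) by (apply Rinv_0_lt_compat; lra).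
(* a radius beyond |z| whose circle already contradicts |F(z)/z| = q > 1 *)
set (r := (Rmax (Cmod z) (/ q) + 1) / 2).
assert (Hm : Rmax (Cmod z) (/ q) < 1) by now apply Rmax_lub_lt.
assert (R1 := Rmax_l (Cmod z) (/ q)); assert (R2 := Rmax_r (Cmod z) (/ q)).
assert (Hr : / q < r < 1) by (unfold r; lra).
assert (K : q <= / r).
{ apply (maximum_principle _ r (/ r) HQ); [lra| | |unfold r; lra].
  - left; apply Rinv_0_lt_compat; lra.
  - intros w Hw; unfold div_id.
    destruct (Ceq_dec w (RtoC 0)) as [->|NZ]; [rewrite Cmod_0 in Hw; lra|].
    rewrite Cmod_div, Hw by exact NZ.
    assert (Cmod (F w) <= 1) by (apply HB; unfold unit_disk; lra).
    unfold Rdiv; rewrite <- (Rmult_1_l (/ r)) at 2.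
    apply Rmult_le_compat_r; [left; apply Rinv_0_lt_compat; lra|assumption]. }
apply Rinv_le_contravar in K; [rewrite Rinv_inv in K; lra|lra].
Qed.

Lemma moebius_bound (q w : C) : Cmod q <= 1 -> Cmod w <= 1 ->
  Cmod (w - q) <= Cmod (1 - Cconj q * w).
Proof.
intros Hq Hw; apply Rsqr_incr_0_var; [|apply Cmod_ge_0]; rewrite !Rsqr_pow2.
assert (E : Cmod (1 - Cconj q * w) ^ 2 - Cmod (w - q) ^ 2
  = (1 - Cmod q ^ 2) * (1 - Cmod w ^ 2))
  by (rewrite !Cmod2_alt; unfold Re, Im; cbn; ring).
generalize (Cmod_ge_0 q) (Cmod_ge_0 w); intros.
assert (0 <= (1 - Cmod q ^ 2) * (1 - Cmod w ^ 2)) by (apply Rmult_le_pos; nra).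
lra.
Qed.

(** If |c 0| < 1, the Moebius transform (Q - q)/(1 - conj(q) Q), q = c 0, vanishes at 0 and
    has derivative c 1 / (1 - |q|^2) there, so the Schwarz lemma applies.  If
    |c 0| = 1, then |Q| has a maximum at 0 and [four_point_mean] gives c 1 = 0. *)
Lemma schwarz_pick_coef (c : nat -> C) (Q : C -> C) :
  holomorphic Q -> jet 2 c Q -> (forall z, unit_disk z -> Cmod (Q z) <= 1) ->
  Cmod (c 1%nat) <= 1 - Cmod (c O) ^ 2.
Proof.
intros HQ JQ HB.
assert (D0 : unit_disk (RtoC 0)) by (unfold unit_disk; rewrite Cmod_0; lra).
assert (Q0 : Q (RtoC 0) = c O) by exact (jet_at0 _ _ _ JQ).
set (q := c O) in *.
assert (Hq : Cmod q <= 1) by (rewrite <- Q0; now apply HB).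
destruct (Rle_lt_or_eq_dec _ _ Hq) as [L|E].
- set (den := fun z => (1 + - Cconj q * Q z)%C).
  assert (Dq : forall w, Cmod w <= 1 -> (1 + - Cconj q * w <> RtoC 0)%C).
  { intros w Hw Z.
    assert (X : Cmod (Cconj q * w) = 1).
    { replace (Cconj q * w)%C with (1 - (1 + - Cconj q * w))%C by ring.
      rewrite Z; replace (1 - RtoC 0)%C with (RtoC 1) by ring; apply Cmod_1. }
    rewrite Cmod_mult, Cmod_conj in X; generalize (Cmod_ge_0 q) (Cmod_ge_0 w); nra. }
  set (k := fun z => ((- q + 1 * Q z) * / den z)%C).
  assert (Hden : holomorphic den) by now apply holomorphic_affine.
  assert (Hk : holomorphic k).
  { apply holomorphic_quotient; [now apply holomorphic_affine|exact Hden|].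
    intros z Hz; now apply Dq, HB. }
  destruct (holomorphic_jet0 k 2 Hk) as [d Jd].
  assert (d0 : d O = RtoC 0).
  { rewrite <- (jet_at0 _ _ _ Jd); unfold k; rewrite Q0; ring. }
  assert (Bk : forall z, unit_disk z -> Cmod (k z) <= 1).
  { intros z Hz; unfold k; assert (N := Dq _ (HB z Hz)); fold (den z) in N.
    rewrite Cmod_mult, Cmod_inv by exact N.
    apply Cmod_gt_0 in N; apply Rmult_le_reg_r with (1 := N).
    rewrite Rmult_assoc, Rinv_l by lra.
    assert (M := moebius_bound q (Q z) Hq (HB z Hz)).
    replace (- q + 1 * Q z)%C with (Q z - q)%C by ring.
    replace (den z) with (1 - Cconj q * Q z)%C by (unfold den; ring); lra. }
  assert (B1 := schwarz_quotient d k Hk Jd d0 Bk _ D0); unfold div_id in B1.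
  destruct (Ceq_dec (RtoC 0) (RtoC 0)) as [_|N]; [|contradiction].
  (* compare the first-order terms in Q = q + k (1 - conj(q) Q) *)
  assert (E1 : c 1%nat = ((1 - Cmod q ^ 2)%R * d 1%nat)%C).
  { assert (Jden := jet_plus _ _ _ _ _ (jet_const 2 (RtoC 1)) (jet_scal 2 (- Cconj q)%C _ _ JQ)).
    assert (JR := jet_plus _ _ _ _ _ (jet_const 2 q) (jet_mult _ _ _ _ _ Jd Jden)).
    rewrite (jet_unique 2 _ _ _ _ JQ JR); [|..|lia].
    - rewrite RtoC_minus, Cmod2_conj.
      cbn; unfold shift; rewrite d0; fold q; ring.
    - exists 1; split; [lra|]; intros h Hh _.
      unfold k; fold (den h).
      assert (N : den h <> RtoC 0) by now apply Dq, HB.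
      field; exact N. }
  assert (P : 0 <= 1 - Cmod q ^ 2) by (generalize (Cmod_ge_0 q); nra).
  rewrite E1, Cmod_mult, Cmod_R, (Rabs_pos_eq _ P); nra.
- destruct (holomorphic_jet0 Q 3 HQ) as [d Jd].
  assert (U := jet_unique 2 _ _ _ _ JQ (jet_pred _ _ _ Jd) (near0_all _ (fun h _ => eq_refl))).
  assert (Z : Cmod (d 1%nat) ^ 2 <= 0).
  { apply four_point_mean with (1 := Jd) (beta := RtoC 0).
    exists 1; split; [lra|]; intros h Hh.
    rewrite <- (U O) by lia; fold q; rewrite E.
    replace (Re (RtoC 0 * h)) with 0 by (unfold Re; cbn; ring).
    generalize (HB h Hh) (Cmod_ge_0 (Q h)); nra. }
  rewrite (U 1%nat), E by lia; generalize (Cmod_ge_0 (d 1%nat)); nra.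
Qed.

(** Schwarz--Pick for u(z)/z: the sharp relation between the first two coefficients of a
    Schwarz function, on which both final bounds rest. *)
Lemma schwarz_function_coef (c : nat -> C) (u : C -> C) :
  schwarz_function u -> jet 3 c u ->
  Cmod (c 2%nat) <= 1 - Cmod (c 1%nat) ^ 2.
Proof.
intros [Hu [Hb H0]] J.
assert (c0 : c O = RtoC 0) by (rewrite <- (jet_at0 _ _ _ J); exact H0).
assert (HF := analytic_holomorphic _ Hu); assert (J2 := jet_pred _ _ _ J).
apply (schwarz_pick_coef (shift c) (div_id (c 1%nat) u)).
- now apply holomorphic_div_id.
- exact (jet_div_id 1 c u J c0).
- apply schwarz_quotient; auto.
  intros z Hz; left; exact (Hb z Hz).
Qed.

(** * Coefficients of subordinate and inverse functions *)

Lemma expansion_series (f : C -> C) (a : nat -> C) :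
  has_expansion f a -> series_near0 a f.
Proof.
intros H; exists 1; split; [lra|]; intros h Hh; now apply is_pseries_sums_to, H.
Qed.

Lemma analytic_C_derive (f : C -> C) : analytic_on_disk f ->
  derivative_near0 f (C_derive f).
Proof.
intros Hf; exists 1; split; [lra|]; intros z Hz.
destruct (analytic_series f z Hf Hz) as [c H].
assert (J := series_jet 2 _ _ H); exists c; split; [exact J|].
symmetry; now apply jet2_C_derive.
Qed.

Lemma lambda_mean_jet (lam : R) (f : C -> C) (a : nat -> C) :
  analytic_on_disk f -> series_near0 a f -> a O = RtoC 0 -> a 1%nat = RtoC 1 ->
  jet 3 (fun k => RtoC (1 - lam) * a (S k) + RtoC lam * (INR (S k) * a (S k)))%C
    (lambda_mean lam f).
Proof.
intros Hf Ha a0 a1.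
refine (jet_plus 3 _ _ _ _ (jet_scal 3 _ _ _ _)
  (jet_scal 3 _ _ _ (derivative_jet 3 a f _ Ha (analytic_C_derive f Hf)))).
assert (J := jet_div_id 2 a f (series_jet 4 _ _ Ha) a0).
rewrite a1 in J; exact J.
Qed.

(** [u1] and [u2] are the first two coefficients of the Schwarz function u with
    F = phi o u. *)
Lemma subordinate_coef (phi F : C -> C) (B c : nat -> C) :
  has_expansion phi B -> jet 3 c F -> subordinate F phi ->
  exists u1 u2 : C, Cmod u2 <= 1 - Cmod u1 ^ 2 /\
    c 1%nat = (B 1%nat * u1)%C /\
    c 2%nat = (B 1%nat * u2 + B 2%nat * u1 * u1)%C.
Proof.
intros Hphi JF [u [Hu Hsub]].
destruct (holomorphic_jet0 u 4 (analytic_holomorphic _ (proj1 Hu))) as [d Jd].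
exists (d 1%nat), (d 2%nat); split.
{ apply schwarz_function_coef with u; [exact Hu|now apply jet_pred]. }
assert (d0 : d O = RtoC 0) by (rewrite <- (jet_at0 _ _ _ Jd); apply Hu).
assert (JB := jet_comp 3 _ _ _ _ (series_jet 3 _ _ (expansion_series _ _ Hphi)) Jd d0).
assert (U := jet_unique 3 _ _ _ _ JF JB).
split; rewrite U; try lia; try (exists 1; split; [lra|]; intros h Hh _; now apply Hsub);
  cbn; unfold shift; rewrite ?d0; ring.
Qed.

Lemma inverse_coef (f g : C -> C) (a b : nat -> C) :
  jet 5 a f -> a O = RtoC 0 -> a 1%nat = RtoC 1 -> jet 4 b g ->
  near0 (fun z => g (f z) = z) ->
  b O = RtoC 0 /\ b 1%nat = RtoC 1 /\ b 2%nat = (- a 2%nat)%C /\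
  b 3%nat = (2 * a 2%nat * a 2%nat - a 3%nat)%C.
Proof.
intros Ja a0 a1 Jb Hgf.
assert (JX : jet 4 (jet_X (RtoC 0)) (fun z => z)).
{ apply jet_near with (3 := jet_translation 4 (RtoC 0)); [reflexivity|].
  apply near0_all; intros h; ring. }
assert (U := jet_unique 4 _ _ _ _ (jet_comp 4 b a g f Jb Ja a0) JX
  (near0_imp _ _ (fun z E _ => E) Hgf)).
assert (U0 := U 0%nat ltac:(lia)); assert (U1 := U 1%nat ltac:(lia)).
assert (U2 := U 2%nat ltac:(lia)); assert (U3 := U 3%nat ltac:(lia)).
cbn in U0, U1, U2, U3; unfold shift in *; rewrite ?a0, ?a1 in *.
assert (E1 : b 1%nat = RtoC 1) by (rewrite <- U1; ring).
assert (E2 : b 2%nat = (- a 2%nat)%C).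
{ transitivity ((RtoC 0) - a 2%nat * b 1%nat)%C; [rewrite <- U2; ring|rewrite E1; ring]. }
repeat split; auto.
transitivity (RtoC 0 - a 3%nat * b 1%nat - 2 * a 2%nat * b 2%nat)%C;
  [rewrite <- U3; ring|rewrite E1, E2; ring].
Qed.

(** * From the coefficient relations to the bounds *)

Lemma Cmod_comb (x y : R) (z w : C) (t s : R) : 0 <= x -> 0 <= y ->
  Cmod z <= t -> Cmod w <= s -> Cmod (x * z + y * w) <= x * t + y * s.
Proof.
intros Hx Hy Hz Hw; eapply Rle_trans; [apply Cmod_triangle|].
rewrite !Cmod_mult, !Cmod_R, !Rabs_pos_eq by assumption.
apply Rplus_le_compat; now apply Rmult_le_compat_l.
Qed.

(** The left side is affine in s and s ranges over the interval from 0 to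
    tau B1 / (D + tau B1); the two terms of the maximum are its values at the end points. *)
Lemma affine_bound (B1 tau D s : R) : 0 < B1 -> 0 < tau -> 0 <= D -> 0 <= s ->
  (D + tau * B1) * s <= tau * B1 ->
  B1 * (1 - s) + (B1 ^ 2 - D) / tau * s <= B1 * Rmax (B1 ^ 2 / (D + tau * B1)) 1.
Proof.
intros HB Ht HD Hs H.
assert (P : 0 < tau * B1) by now apply Rmult_lt_0_compat.
replace (B1 * (1 - s) + (B1 ^ 2 - D) / tau * s)
  with (B1 + s * ((B1 ^ 2 - D - tau * B1) / tau)) by (field; lra).
destruct (Rle_lt_dec (B1 ^ 2 - D - tau * B1) 0) as [N|N].
- apply Rle_trans with (B1 * 1); [|apply Rmult_le_compat_l; [lra|apply Rmax_r]].
  assert ((B1 ^ 2 - D - tau * B1) / tau <= 0).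
  { apply Rmult_le_reg_r with (1 := Ht); unfold Rdiv; rewrite Rmult_assoc, Rinv_l; lra. }
  nra.
- apply Rle_trans with (B1 * (B1 ^ 2 / (D + tau * B1)));
    [|apply Rmult_le_compat_l; [lra|apply Rmax_l]].
  replace (B1 * (B1 ^ 2 / (D + tau * B1))) with
    (B1 + tau * B1 / (D + tau * B1) * ((B1 ^ 2 - D - tau * B1) / tau)) by (field; lra).
  apply Rplus_le_compat_l, Rmult_le_compat_r.
  + apply Rlt_le, Rdiv_lt_0_compat; assumption.
  + apply Rmult_le_reg_r with (D + tau * B1); [lra|].
    unfold Rdiv; rewrite Rmult_assoc, Rinv_l by lra; lra.
Qed.

(** Write s = |u1|^2, M = B1^2 - tau B2 and D = |M|.  Adding the two relations for [a3]
    gives 2 M u1^2 = tau B1 (u2 + v2), hence D s <= tau B1 (1 - s); with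
    p tau |a2|^2 = B1^2 s this is the bound on [a2].

    For [a3], if D <= B1^2 then p a3 is B1 u2 or - B1 v2, according to the sign of M, plus
    (B1^2 - D) u1^2 / tau, and [affine_bound] concludes.  If D > B1^2, then
    2 M p a3 = B1 ((B1^2 + M) u2 + (B1^2 - M) v2), where the moduli of the two coefficients
    add up to 2 D, so that p |a3| <= B1 (1 - s). *)
Lemma coefficient_bounds (B1 B2 p tau : R) (a2 a3 u1 u2 v2 : C) :
  0 < B1 -> 0 < p -> 0 < tau ->
  (p * tau * (a2 * a2) = B1 * B1 * (u1 * u1))%C ->
  (p * a3 = B1 * u2 + B2 * (u1 * u1))%C ->
  (p * (2 * (a2 * a2) - a3) = B1 * v2 + B2 * (u1 * u1))%C ->
  Cmod u2 <= 1 - Cmod u1 ^ 2 -> Cmod v2 <= 1 - Cmod u1 ^ 2 ->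
  let D := Rabs (B1 ^ 2 - tau * B2) in
  p * Cmod a2 ^ 2 * (D + tau * B1) <= B1 ^ 3 /\
  Cmod a3 <= B1 / p * Rmax (B1 ^ 2 / (D + tau * B1)) 1.
Proof.
intros HB Hp Ht Ea Eu Ev Hu Hv D.
set (s := Cmod u1 ^ 2) in *; set (M := B1 ^ 2 - tau * B2) in *.
assert (Ns : Cmod (u1 * u1) = s) by (unfold s; rewrite Cmod_mult; ring).
assert (Hs : 0 <= s) by apply pow2_ge_0.
assert (HD : 0 <= D) by apply Rabs_pos.
assert (Ct : RtoC tau <> RtoC 0) by (intros E; apply RtoC_inj in E; lra).
assert (P : 0 < tau * B1) by now apply Rmult_lt_0_compat.
assert (EM : RtoC M = (B1 * B1 - tau * B2)%C)
  by (unfold M; rewrite RtoC_minus, !RtoC_mult; cbn; rewrite !RtoC_mult; ring).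
assert (E2 : (M * (2 * (u1 * u1)) = RtoC (tau * B1) * u2 + RtoC (tau * B1) * v2)%C).
{ transitivity (2 * (B1 * B1 * (u1 * u1)) - 2 * tau * (B2 * (u1 * u1)))%C;
    [rewrite EM; ring|].
  rewrite <- Ea.
  transitivity (tau * (p * a3 + p * (2 * (a2 * a2) - a3) - 2 * (B2 * (u1 * u1))))%C;
    [ring|rewrite Eu, Ev, RtoC_mult; ring]. }
assert (Hsum : (D + tau * B1) * s <= tau * B1).
{ assert (K : Cmod (M * (2 * (u1 * u1))) <= tau * B1 * (1 - s) + tau * B1 * (1 - s))
    by (rewrite E2; apply Cmod_comb; lra).
  rewrite !Cmod_mult, <- Cmod_mult, Ns, !Cmod_R, (Rabs_pos_eq 2) in K by lra.
  fold D in K; nra. }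
assert (Ha : p * tau * Cmod a2 ^ 2 = B1 ^ 2 * s).
{ assert (K := f_equal Cmod Ea).
  rewrite !Cmod_mult, !Cmod_R, !Rabs_pos_eq in K by lra.
  unfold s; lra. }
split.
- apply Rmult_le_reg_l with (1 := Ht).
  replace (tau * (p * Cmod a2 ^ 2 * (D + tau * B1)))
    with (p * tau * Cmod a2 ^ 2 * (D + tau * B1)) by ring.
  rewrite Ha; apply Rle_trans with (B1 ^ 2 * (tau * B1)); [|right; ring].
  rewrite Rmult_assoc, (Rmult_comm s).
  apply Rmult_le_compat_l; [apply pow2_ge_0|exact Hsum].
- apply Rmult_le_reg_l with (1 := Hp).
  replace (p * (B1 / p * Rmax (B1 ^ 2 / (D + tau * B1)) 1))
    with (B1 * Rmax (B1 ^ 2 / (D + tau * B1)) 1) by (field; lra).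
  rewrite <- (Rabs_pos_eq p) at 1 by lra; rewrite <- Cmod_R, <- Cmod_mult.
  assert (Ea' : (p * (a2 * a2) = B1 * B1 / tau * (u1 * u1))%C).
  { transitivity (p * tau * (a2 * a2) / tau)%C; [|rewrite Ea]; field; exact Ct. }
  destruct (Rle_lt_dec D (B1 ^ 2)) as [L|L].
  + apply Rle_trans with (2 := affine_bound B1 tau D s HB Ht HD Hs Hsum).
    assert (C0 : 0 <= (B1 ^ 2 - D) / tau).
    { apply Rmult_le_pos; [lra|left; now apply Rinv_0_lt_compat]. }
    destruct (Rle_lt_dec 0 M) as [S|S].
    * assert (EB : B2 = (B1 ^ 2 - D) / tau)
        by (unfold D; rewrite Rabs_pos_eq by exact S; unfold M; field; lra).
      rewrite Eu, EB; apply Cmod_comb; lra.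
    * assert (EB : 2 * (B1 * B1 / tau) - B2 = (B1 ^ 2 - D) / tau)
        by (unfold D; rewrite Rabs_left by exact S; unfold M; field; lra).
      replace (p * a3)%C with (B1 * - v2 + RtoC ((B1 ^ 2 - D) / tau) * (u1 * u1))%C.
      { apply Cmod_comb; try lra; rewrite Cmod_opp; exact Hv. }
      rewrite <- EB, RtoC_minus, RtoC_mult, RtoC_div, RtoC_mult by lra.
      transitivity (2 * (B1 * B1 / tau * (u1 * u1)) - (B1 * v2 + B2 * (u1 * u1)))%C;
        [ring|rewrite <- Ea', <- Ev; ring].
  + apply Rle_trans with (B1 * 1); [|apply Rmult_le_compat_l; [lra|apply Rmax_r]].
    assert (D0 : 0 < D) by (generalize (pow2_ge_0 B1); lra).
    apply Rmult_le_reg_l with (2 * D); [lra|].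
    assert (E3 : (2 * M * (p * a3) =
      B1 * ((B1 * B1 + M) * u2 + (B1 * B1 - M) * v2))%C).
    { assert (X : (B1 * u2 = p * a3 - B2 * (u1 * u1))%C) by (rewrite Eu; ring).
      assert (Y : (B1 * v2 = p * (2 * (a2 * a2) - a3) - B2 * (u1 * u1))%C)
        by (rewrite Ev; ring).
      transitivity ((B1 * B1 + M) * (B1 * u2) + (B1 * B1 - M) * (B1 * v2))%C; [|ring].
      rewrite X, Y.
      transitivity (2 * M * (p * a3) - 2 * M * (p * (a2 * a2)) +
         2 * (B1 * B1) * (p * (a2 * a2) - B2 * (u1 * u1)))%C; [|ring].
      rewrite Ea', EM; field; exact Ct. }
    assert (E4 : 2 * D * Cmod (p * a3) = Cmod (2 * M * (p * a3)))
      by (rewrite !Cmod_mult, !Cmod_R, (Rabs_pos_eq 2) by lra; reflexivity).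
    rewrite E4, E3, Cmod_mult, Cmod_R, (Rabs_pos_eq B1) by lra.
    assert (Q : Cmod ((B1 * B1 + M) * u2 + (B1 * B1 - M) * v2) <= 2 * D); [|nra].
    rewrite <- RtoC_mult, <- RtoC_plus, <- RtoC_minus.
    eapply Rle_trans; [apply Cmod_triangle|]; rewrite !Cmod_mult, !Cmod_R.
    assert (W : Rabs (B1 * B1 + M) + Rabs (B1 * B1 - M) = 2 * D).
    { generalize (pow2_ge_0 B1); unfold D in *; revert L; unfold Rabs.
      repeat destruct Rcase_abs; lra. }
    generalize (Rabs_pos (B1 * B1 + M)) (Rabs_pos (B1 * B1 - M))
      (Cmod_ge_0 u2) (Cmod_ge_0 v2); intros; nra.
Qed.

Lemma le_div_sqrt (B1 p E x : R) : 0 < B1 -> 0 < p -> 0 < E -> 0 <= x ->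
  p * x ^ 2 * E <= B1 ^ 3 -> x <= B1 * sqrt B1 / sqrt (p * E).
Proof.
intros HB Hp HE Hx H.
assert (HS : 0 < p * E) by now apply Rmult_lt_0_compat.
assert (HQ := sqrt_lt_R0 _ HS).
apply Rmult_le_reg_r with (1 := HQ); unfold Rdiv; rewrite Rmult_assoc, Rinv_l, Rmult_1_r by lra.
apply Rsqr_incr_0_var; [|apply Rmult_le_pos; [lra|apply sqrt_pos]].
rewrite !Rsqr_mult, !Rsqr_sqrt by lra; unfold Rsqr; lra.
Qed.

Theorem theorem1p3 :
  forall (phi : C -> C) (B : nat -> C) (B1 B2 : R),
    analytic_on_disk phi ->
    has_expansion phi B ->
    B 0%nat = RtoC 1 ->
    B 1%nat = RtoC B1 ->
    B 2%nat = RtoC B2 ->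
    0 < B1 ->
  forall (lam : R), 0 <= lam ->
  forall (f : C -> C) (a : nat -> C),
    normalized_expansion f a ->
    class_R_sigma lam phi f ->
  let tau := (1 + lam) ^ 2 / (1 + 2 * lam) in
  (tau * B2 <= B1 ^ 2 ->
     Cmod (a 2%nat) <=
       B1 * sqrt B1 /
         sqrt ((1 + 2 * lam) * (B1 ^ 2 - tau * B2 + tau * B1)) /\
     Cmod (a 3%nat) <=
       B1 / (1 + 2 * lam) *
         Rmax (B1 ^ 2 / (B1 ^ 2 - tau * B2 + tau * B1)) 1) /\
  (B1 ^ 2 <= tau * B2 ->
     Cmod (a 2%nat) <=
       B1 * sqrt B1 /
         sqrt ((1 + 2 * lam) * (tau * B2 + tau * B1 - B1 ^ 2)) /\
     Cmod (a 3%nat) <=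
       B1 / (1 + 2 * lam) *
         Rmax (B1 ^ 2 / (tau * B2 + tau * B1 - B1 ^ 2)) 1).
Proof.
intros phi B B1 B2 _ Hphi _ EB1 EB2 HB lam Hlam f a [a0 [a1 Ha]]
  [[_ [[Hf _] _]] [Sf [g [[[Hg _] Hgf] Sg]]]] tau.
assert (HA := expansion_series _ _ Ha).
assert (D0 : unit_disk (RtoC 0)) by (unfold unit_disk; rewrite Cmod_0; lra).
destruct (analytic_series g (RtoC 0) Hg D0) as [b Hb0].
assert (Hb : series_near0 b g).
{ revert Hb0; apply near0_imp; intros h E; now rewrite Cplus_0_l in E. }
(* f tends to 0 at 0, so it is eventually below the Koebe radius 1/4 *)
assert (Ginv : near0 (fun z => g (f z) = z)).
{ assert (F0 : f (RtoC 0) = RtoC 0) by (rewrite (jet_at0 0 a f (series_jet 1 _ _ HA)); exact a0).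
  destruct (jet_continuous a f (RtoC 0) (1 / 4)) as [d [Hd K]]; [|lra|].
  - apply jet_near with (3 := series_jet 1 _ _ HA); [reflexivity|].
    apply near0_all; intros h; now rewrite Cplus_0_l.
  - generalize (near0_and _ _ (near0_ball _ Hd) (near0_ball 1 Rlt_0_1)).
    apply near0_imp; intros h [H1 H2]; apply Hgf; [exact H2|].
    replace (f h) with (f h - f (RtoC 0))%C by (rewrite F0; ring).
    apply K; now replace (h - RtoC 0)%C with h by ring. }
destruct (inverse_coef f g a b (series_jet 5 _ _ HA) a0 a1 (series_jet 4 _ _ Hb) Ginv)
  as [b0 [b1 [b2 b3]]].
destruct (subordinate_coef phi _ B _ Hphi (lambda_mean_jet lam f a Hf HA a0 a1) Sf)
  as [u1 [u2 [Hu [U1 U2]]]].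
destruct (subordinate_coef phi _ B _ Hphi (lambda_mean_jet lam g b Hg Hb b0 b1) Sg)
  as [v1 [v2 [Hv [V1 V2]]]].
rewrite EB1, ?EB2, ?b2, ?b3 in *.
replace (RtoC (INR 2)) with (RtoC 2) in * by (f_equal; cbn; ring).
replace (RtoC (INR 3)) with (RtoC 3) in * by (f_equal; cbn; ring).
rewrite RtoC_minus in *.
assert (CB : RtoC B1 <> RtoC 0) by (intros E; apply RtoC_inj in E; lra).
assert (Ev1 : v1 = (- u1)%C).
{ transitivity (B1 * v1 / B1)%C; [field; exact CB|].
  rewrite <- V1; transitivity (- (B1 * u1) / B1)%C; [rewrite <- U1|]; field; exact CB. }
subst v1; rewrite Cmod_opp in Hv.
assert (Hp : 0 < 1 + 2 * lam) by lra.
assert (Ht : 0 < tau) by (apply Rdiv_lt_0_compat; [apply pow_lt|]; lra).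
destruct (coefficient_bounds B1 B2 (1 + 2 * lam) tau (a 2%nat) (a 3%nat) u1 u2 v2)
  as [R2 R3]; auto.
- transitivity ((B1 * u1) * (B1 * u1))%C; [|ring]; rewrite <- U1.
  assert (X : ((1 + 2 * lam)%R * tau = (1 + lam) * (1 + lam))%C).
  { rewrite <- RtoC_mult, <- RtoC_plus, <- RtoC_mult; f_equal; unfold tau; field; lra. }
  rewrite X; ring.
- rewrite Cmult_assoc, <- U2, RtoC_plus, RtoC_mult; ring.
- transitivity (B1 * v2 + B2 * - u1 * - u1)%C; [|ring].
  rewrite <- V2, RtoC_plus, RtoC_mult; ring.
- assert (P : 0 < tau * B1) by now apply Rmult_lt_0_compat.
  split; intros L.
  + rewrite Rabs_pos_eq in R2, R3 by lra.
    split; [|exact R3]; apply le_div_sqrt; auto; [lra|apply Cmod_ge_0].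
  + replace (tau * B2 + tau * B1 - B1 ^ 2) with (Rabs (B1 ^ 2 - tau * B2) + tau * B1)
      by (rewrite Rabs_left1 by lra; ring).
    split; [|exact R3]; apply le_div_sqrt; auto; [|apply Cmod_ge_0].
    generalize (Rabs_pos (B1 ^ 2 - tau * B2)); lra.
Qed.
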